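(* Let $\sigma\ge2$ be an integer and let $C$ be the invasion percolation cluster on $\mathcal{T}_\sigma$, with law $\mathbb{P}$. Under $\mathbb{P}$, $C$ consists of: (1) a single uniformly random infinite backbone (i.e. almost surely there is exactly one infinite self-avoiding path from $o$ in $C$, and each of its successive vertices is chosen uniformly and independently among the $\sigma$ children of the preceding vertex); (2) for all $k\in\mathbb{N}_0$, emerging from the $k$th vertex along the backbone, in all directions away from the backbone, an independent supercritical percolation cluster with parameter $W_k$ conditioned to stay finite. That is, conditionally on the backbone $(v_k)_{k\ge0}$ and on $W=(W_k)_{k\ge0}$, the parts of $C$ in the different branches off the backbone are independent, and for each $k$ and each child $y\neq v_{k+1}$ of $v_k$, the part of $C$ in the branch consisting of the edge $\{v_k,y\}$ and the subtree of descendants of $y$ is distributed as the open cluster of $v_k$ in this branch for independent bond percolation with parameter $W_k$, conditioned on this cluster being finite.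
   Context: $\mathcal{T}_\sigma$ is the infinite rooted tree in which every vertex has exactly $\sigma$ children, with root $o$. Invasion percolation cluster: assign i.i.d. uniform $(0,1)$ weights to the edges of $\mathcal{T}_\sigma$. Let $I_0=\{o\}$ and, given $I_N$, let $I_{N+1}$ be obtained by adjoining to $I_N$ the edge in its boundary (edges with exactly one endpoint in $I_N$) with smallest weight, together with its other endpoint. Then $C=\bigcup_{N\ge 0} I_N$. The backbone is the almost surely unique infinite self-avoiding path $o=v_0,v_1,v_2,\dots$ from $o$ in $C$. $B_l$, $l\in\mathbb{N}$, is the weight of its $l$th edge $\{v_{l-1},v_l\}$, and $W_k=\max_{l>k}B_l$, $k\in\mathbb{N}_0$ (the maximum is attained and $W_k>p_c=1/\sigma$ almost surely). *)

(* Defs.v *)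
From mathcomp Require Export all_boot all_order all_algebra.
From mathcomp Require Export all_classical all_reals all_analysis.

Set Implicit Arguments.
Unset Strict Implicit.
Unset Printing Implicit Defensive.

Import Order.TTheory GRing.Theory Num.Theory.
Local Open Scope classical_set_scope.
Local Open Scope ring_scope.

Section Tree.
Variable sigma : nat.

(* Vertices of the sigma-ary tree are finite words over {0, .., sigma - 1}: the
   root o is [::] and the children of x are the words rcons x i. *)
Definition vertex : Type := seq 'I_sigma.

(* (x, i) stands for the edge {x, rcons x i}. *)
Definition edge : Type := (vertex * 'I_sigma)%type.

Definition child (e : edge) : vertex := rcons e.1 e.2.

Definition joins (e : edge) (x y : vertex) : bool :=
  ((x == e.1) && (y == child e)) || ((x == child e) && (y == e.1)).

(* Every edge containing x is (x, i), or (y, i) with y the other endpoint. *)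
Definition adjacent (x y : vertex) : bool :=
  [exists i : 'I_sigma, joins (x, i) x y || joins (y, i) x y].

Definition open_adjacent (open : edge -> bool) (x y : vertex) : bool :=
  [exists i : 'I_sigma, (open (x, i) && joins (x, i) x y)
                     || (open (y, i) && joins (y, i) x y)].

(* The branch through e = {x, y}, y child of x: the vertex x, the edge e, and
   the subtree of descendants of y. *)
Definition branch (e : edge) : pred vertex :=
  [pred z | (z == e.1) || prefix (child e) z].

(* Connected subgraphs of the tree are identified with their vertex sets: the
   edges of such a subgraph are all the tree edges with both endpoints in it. *)
Definition open_cluster (open : edge -> bool) (S : pred vertex) (x : vertex) :
    set vertex :=
  [set z | exists p : seq vertex,
     [/\ path (open_adjacent open) x p, all S p & last x p = z]].

Definition infinite_self_avoiding_path (C : set vertex) (p : nat -> vertex) :=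
  [/\ p 0%N = [::], (forall n, adjacent (p n) (p n.+1)), injective p
    & forall n, C (p n)].

(* The unique infinite self-avoiding path in C starting from the root; the
   constant sequence [::] if there is none or more than one. *)
Definition backbone (C : set vertex) : nat -> vertex :=
  xget (fun=> [::]) [set p | unique (infinite_self_avoiding_path C) p].

Section Weights.
Variables (R : realType) (w : edge -> R).

Definition boundary (I : set vertex) : set edge :=
  [set e | (I e.1 /\ ~ I (child e)) \/ (~ I e.1 /\ I (child e))].

Definition smallest_boundary_edge (I : set vertex) : set edge :=
  [set e | boundary I e /\ forall f, boundary I f -> w e <= w f].

(* If several boundary edges have the smallest weight, all of them are
   adjoined; for i.i.d. uniform weights this has probability zero. *)
Fixpoint invasion (N : nat) : set vertex :=
  if N is N'.+1 then
    invasion N' `|`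
    \bigcup_(e in smallest_boundary_edge (invasion N')) [set e.1; child e]
  else [set [::]].

Definition ipc : set vertex := \bigcup_N invasion N.

(* Weight of the edge from y to its parent; irrelevant value 0 at the root.
   Note that i :: u = rcons (belast i u) (last i u). *)
Definition parent_weight (y : vertex) : R :=
  if y is i :: u then w (belast i u, last i u) else 0.

Definition backbone_weight (l : nat) : R := parent_weight (backbone ipc l).

(* W_k is the largest B_l with l > k. *)
Definition max_future_weight (k : nat) : R :=
  sup [set backbone_weight l | l in [set l | (k < l)%N]].

(* The branch through e emerges from the backbone: the upper endpoint of e is
   on the backbone (necessarily at height size e.1) and the lower one is not. *)
Definition off_backbone (e : edge) : Prop :=
  let v := backbone ipc in
  v (size e.1) = e.1 /\ v (size e.1).+1 <> child e.

End Weights.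

(* The sigma-algebra on subgraphs, generated by the events "x belongs to C". *)
Definition cluster_event : set (set (set vertex)) :=
  <<s [set A | exists x, A = [set C : set vertex | C x]] >>.

End Tree.

Section Probability.
Context {d : measure_display} {T : measurableType d} {R : realType}.
Variable P : probability T R.

Definition mutually_independent (I : eqType) d' (S : measurableType d')
    (X : I -> T -> S) : Prop :=
  forall (J : seq I) (B : I -> set S), uniq J ->
    (forall i, measurable (B i)) ->
    P [set t | forall i, i \in J -> B i (X i t)] =
    (\prod_(i <- J) P (X i @^-1` B i))%E.

(* Y = P(A | G) almost surely: up to a null set, Y is a G-measurable function
   Z with the defining property of the conditional probability. *)
Definition is_cond_prob (G : set (set T)) (A : set T) (Y : T -> R) : Prop :=
  exists Z : T -> R,
    [/\ (forall B : set R, measurable B -> G (Z @^-1` B)),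
        (forall H, G H -> (\int[P]_(t in H) (Z t)%:E)%E = P (A `&` H))
      & {ae P, forall t, Z t = Y t}].

Variable sigma : nat.

Definition bernoulli_percolation (p : R)
    (open : edge sigma -> {mfun T >-> bool}) : Prop :=
  (forall e, P (open e @^-1` [set true]) = p%:E) /\
  mutually_independent (fun e => open e : T -> bool).

(* P(K in A | K finite), where K is the open cluster of the upper endpoint of e
   in the branch through e. *)
Definition finite_cluster_law (open : edge sigma -> T -> bool) (e : edge sigma)
    (A : set (set (vertex sigma))) : R :=
  let K t := open_cluster (open^~ t) (branch e) e.1 in
  fine (P [set t | finite_set (K t) /\ A (K t)]) /
  fine (P [set t | finite_set (K t)]).

(* The sigma-algebra generated by the backbone (v_k) and by (W_k). *)
Definition backbone_algebra (U : T -> edge sigma -> R) : set (set T) :=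
  <<s [set H | exists k x, H = [set t | backbone (ipc (U t)) k = x]] `|`
      [set H | exists (k : nat) (B : set R), measurable B /\
                 H = [set t | B (max_future_weight (U t) k)]] >>.

End Probability.

(* Main.v *)
From HB Require Import structures.
Require Import Defs.
From mathcomp Require Import measurable_realfun zify ring lra.

(* Let M(e) be the infimum over infinite descending paths through the edge e of
   the supremum of the weights along the path.  For every infinite path v in the
   invasion cluster, with edges e_k = {v_k, v_{k+1}}, one has W_k = M(e_k), which
   is the minimum of M over the edges leaving v_k downwards, and every other
   branch e at v_k meets the cluster in the set of vertices connected to v_k in
   the branch by weights below W_k; this set is finite iff W_k < M(e).  Hence,
   unless M takes the same value at two siblings, the backbone is unique and
   passes through x iff for all branches e off the path to x the percolation
   cluster in e with parameter W_|e| is finite, and on this event W_k is a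
   function of the weights outside these branches.  Fubini's theorem then gives
   the conditional law of the branches.  The distribution function F of M solves
   F = p (1 - (1 - F)^sigma); solving for p shows that M has no atoms, so that
   ties have probability zero. *)

Set Implicit Arguments.
Unset Strict Implicit.
Unset Printing Implicit Defensive.

Import Order.TTheory GRing.Theory Num.Theory.
Import numFieldNormedType.Exports.
Local Open Scope classical_set_scope.
Local Open Scope ring_scope.

(** * Rays in rooted subtrees *)

(** The conditioning on finiteness is produced by the backbone itself: for a fixed word [x], the
    event that the backbone follows [x] is, up to null sets, the event that all branches leaving the
    path have finite clusters at their thresholds. The obstacle is that [W_k] is read off from the
    whole cluster; its substitute, computed along the path and below the last edge, contains no
    weight of these branches, so thresholds can be frozen before the branches are integrated. Taking
    [x] deeper than all branches under study and summing over [x] gives the general case. The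
    distribution function of M has no closed form, and 0 is always a root of its equation. Solved
    for p, the equation reads p = 1 / (sum of (1 - s)^j over j < sigma), which makes sense for every
    s in [0, 1] and gives p = 1 / sigma at s = 0. So every value s is taken, and a distribution
    function that skips no value has no jump. The uniform directions come from the common law of M
    at all edges, not from a relabelling of the tree. *)

Section Rays.
Variable sigma : nat.
Implicit Types (op : edge sigma -> bool) (e f : edge sigma) (x y z : vertex sigma)
  (u : seq 'I_sigma) (C : set (vertex sigma)) (p : nat -> vertex sigma).

(** The path has one edge more than [u] has letters: [e] itself, then the edges met when reading [u]
    below [child e]. *)
Fixpoint open_below op e u : bool :=
  op e && (if u is i :: u' then open_below op (child e, i) u' else true).

Lemma child_cat e i u : child (child e, i) ++ u = child e ++ i :: u.
Proof. by rewrite /child cat_rcons. Qed.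

Lemma open_below_rcons op e u i :
  open_below op e (rcons u i) = open_below op e u && op (child e ++ u, i).
Proof.
elim: u e => [|j u IH] e /=; first by rewrite cats0 !andbT.
by rewrite IH child_cat andbA.
Qed.

Lemma open_below_cat op e u v : open_below op e (u ++ v) -> open_below op e u.
Proof.
elim/last_ind: v => [|v i IH]; first by rewrite cats0.
by rewrite -rcons_cat open_below_rcons => /andP[/IH].
Qed.

Lemma sub_open_below op op' e u : (forall f, op f -> op' f) ->
  open_below op e u -> open_below op' e u.
Proof.
by move=> h; elim: u e => [|i u IH] e /= /andP[/h ->] //= /IH.
Qed.

Lemma size_prefixw x y : prefix x y -> (size x <= size y)%N.
Proof. exact: size_prefix. Qed.

Lemma prefix_eqw x y : prefix x y -> (size y <= size x)%N -> x = y.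
Proof. by rewrite prefixE => + le_yx; rewrite take_oversize// => /eqP. Qed.

Lemma rcons_neq x i : rcons x i <> x.
Proof. by move=> /(congr1 size); rewrite size_rcons => /esym /n_Sn. Qed.

Lemma open_adjacentP op x y : reflect
  (exists i, (op (x, i) /\ y = rcons x i) \/ (op (y, i) /\ x = rcons y i))
  (open_adjacent op x y).
Proof.
apply: (iffP existsP) => -[i H]; exists i; move: H; rewrite /joins /child /=.
- by case/orP=> /andP[oi /orP[]/andP[/eqP h1 /eqP h2]];
    [left|case: (@rcons_neq x i)|case: (@rcons_neq y i)|right].
- by case=> -[-> ->]; rewrite !eqxx ?orbT.
Qed.

Lemma adjacentP x y : reflect
  (exists i, y = rcons x i \/ x = rcons y i) (adjacent x y).
Proof.
have -> : adjacent x y = open_adjacent xpredT x y by [].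
by apply: (iffP (open_adjacentP _ _ _)) => -[i []];
  [move=> [_ ->]|move=> [_ ->]|move=> ->|move=> ->]; exists i; [left|right|left|right].
Qed.

(** Backtracking reaches nothing new in a tree: each step of a path lengthens or shortens the word
    below [child e] by a letter. The auxiliary [h0] excludes the step from [e.1] to its parent,
    which lies outside the branch. *)
Lemma open_clusterP op e z : open_cluster op (branch e) e.1 z <->
  z = e.1 \/ exists2 u, z = child e ++ u & open_below op e u.
Proof.
split.
- case=> s [+ + <-] {z}; elim/last_ind: s => [|s z IH]; first by left.
  rewrite rcons_path all_rcons last_rcons => /andP[/IH{}IH adj] /andP[bz /IH{IH}].
  have h0 i : e.1 = rcons z i -> False.
    move: bz; rewrite /branch /= => /orP[/eqP -> /esym /rcons_neq //|].
    move=> /size_prefixw; rewrite /child size_rcons => + /(congr1 size).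
    by rewrite size_rcons; lia.
  case=> [eq1|[u eq1 opu]]; move: adj; rewrite eq1 => /open_adjacentP[i [[oi zE]|[oi xE]]].
  + right; exists [::]; rewrite ?cats0 /= ?andbT.
    * by move: bz; rewrite zE /= => /orP[/eqP/rcons_neq//|/prefix_eqw->//]; rewrite !size_rcons.
    * move: bz oi; rewrite zE /= => /orP[/eqP/rcons_neq//|/prefix_eqw].
      rewrite /child !size_rcons => /(_ (leqnn _)) /rcons_inj[<-].
      by rewrite -surjective_pairing.
  + by case: (h0 i).
  + right; exists (rcons u i); first by rewrite zE rcons_cat.
    by rewrite open_below_rcons opu oi.
  + case: (lastP u) eq1 opu xE oi => [|{}u j] eq1 opu xE oi.
      by left; move: xE; rewrite cats0 /child => /rcons_inj[].
    move: xE; rewrite -rcons_cat => /rcons_inj[zE _]; right; exists u => //.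
    by move: opu; rewrite open_below_rcons => /andP[].
- case=> [->|[u -> {z}]]; first by exists [::].
  elim/last_ind: u => [|u i IH] => [/=|].
    rewrite andbT cats0 => oe; exists [:: child e]; rewrite /= !andbT; split => //.
      apply/open_adjacentP; exists e.2; left; split=> //.
      by rewrite -surjective_pairing.
    by apply/orP; right; exact: prefix_refl.
  rewrite open_below_rcons => /andP[/IH [s [ps as_ ls]] oi].
  exists (rcons s (child e ++ rcons u i)); rewrite last_rcons rcons_path all_rcons.
  rewrite ps as_ ls /=; split=> //=; last by rewrite andbT; apply/orP; right; exact: prefix_prefix.
  by apply/open_adjacentP; exists i; left; rewrite rcons_cat.
Qed.

Definition ray C p := [/\ p 0%N = [::],
  forall n, exists i, p n.+1 = rcons (p n) i & forall n, C (p n)].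

(** The first step from the root goes down, and a step up after a step down returns to the previous
    vertex; so a self-avoiding path only descends. Conversely, heights separate the vertices of a
    descending path. *)
Lemma infinite_self_avoiding_pathE C :
  infinite_self_avoiding_path C = ray C.
Proof.
apply/funext => p; apply/propext; split=> [[p0 adj inj Cp]|[p0 s Cp]].
  split=> // n; elim: n => [|n [j IH]].
    have /adjacentP[i [->|]] := adj 0%N; first by exists i.
    by rewrite p0; case: (p 1%N).
  have /adjacentP[i [->|]] := adj n.+1; first by exists i.
  by rewrite IH => /rcons_inj[/inj h _]; lia.
have sz n : size (p n) = n.
  by elim: n => [|n IH]; [rewrite p0|case: (s n) => i ->; rewrite size_rcons IH].
split=> // [n|m n /(congr1 size)]; last by rewrite !sz.
by case: (s n) => i pi; apply/adjacentP; exists i; left.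
Qed.

Section RayTheory.
Variables (C : set (vertex sigma)) (p : nat -> vertex sigma).
Hypothesis rp : ray C p.

Lemma ray_size n : size (p n) = n.
Proof.
case: rp => p0 s _.
by elim: n => [|n IH]; [rewrite p0|case: (s n) => i ->; rewrite size_rcons IH].
Qed.

Lemma ray_cat k n : exists2 u, p (k + n)%N = p k ++ u & size u = n.
Proof.
case: (rp) => _ s _; elim: n => [|n [u pu su]].
  by exists [::]; rewrite ?addn0 ?cats0.
by have [i pi] := s (k + n)%N; exists (rcons u i);
  rewrite ?size_rcons ?su// addnS pi pu rcons_cat.
Qed.

Lemma ray_take k n : (k <= n)%N -> take k (p n) = p k.
Proof.
move=> /subnKC <-; have [u -> _] := ray_cat k (n - k).
by rewrite take_size_cat// ray_size.
Qed.

End RayTheory.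

Definition downward_closed C := forall x i, C (rcons x i) -> C x.

Lemma downward_closed_cat C x u : downward_closed C -> C (x ++ u) -> C x.
Proof.
move=> dC; elim/last_ind: u => [|u i IH]; first by rewrite cats0.
by rewrite -rcons_cat => /dC.
Qed.

(** For downward closed [C] this amounts to an infinite descending path of [C] through [x]; unlike
    the existence of a path, it is a countable combination of membership events, hence
    measurable. *)
Definition deep C x := forall n, exists2 u, size u = n & C (x ++ u).

Lemma ray_deep C p n : ray C p -> deep C (p n).
Proof.
move=> rp m; have [u pu su] := ray_cat rp n m; exists u => //.
by rewrite -pu; case: rp.
Qed.

(* Koenig's lemma *)
Lemma deep_child C x : downward_closed C -> deep C x ->
  exists i, deep C (rcons x i).
Proof.
move=> dC dx; apply: contrapT => /forallNP noi.
have /choice[N HN] : forall i, exists n, ~ exists2 u, size u = n & C (rcons x i ++ u).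
  by move=> i; apply/existsNP => h; exact: (noi i).
have [u] := dx (\max_i N i).+1; case: u => // i u [su] Cu; apply: (HN i).
exists (take (N i) u).
  by rewrite size_takel// su; exact: (leq_bigmax i).
by apply: (@downward_closed_cat _ _ (drop (N i) u)) => //; rewrite -catA cat_take_drop cat_rcons.
Qed.

Lemma deep_rcons C x i : downward_closed C -> deep C (rcons x i) -> deep C x.
Proof.
move=> dC dx n; have [u su Cu] := dx n.
exists (take n (i :: u)); first by rewrite size_takel//= su.
apply: (@downward_closed_cat _ _ (drop n (i :: u))) => //.
by rewrite -catA cat_take_drop -cat_rcons.
Qed.

Lemma deep_cat C x u : downward_closed C -> deep C (x ++ u) -> deep C x.
Proof.
move=> dC; elim/last_ind: u => [|u i IH]; first by rewrite cats0.
by rewrite -rcons_cat => /deep_rcons-/(_ dC).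
Qed.

Lemma ray_through C x : downward_closed C -> deep C x ->
  exists2 p, ray C p & p (size x) = x.
Proof.
move=> dC dx.
have /choice[h hP] : forall y, exists y', deep C y -> (exists i, y' = rcons y i) /\ deep C y'.
  move=> y; have [dy|ndy] := pselect (deep C y); last by exists y.
  by have [i di] := deep_child dC dy; exists (rcons y i); split => //; exists i.
have dit n : deep C (iter n h x) by elim: n => //= n /hP[].
have deepC y : deep C y -> C y by move=> /(_ 0%N)[u /size0nil ->]; rewrite cats0.
(* The path spells out [x] and from there on iterates the choice [h] of a deep child. *)
exists (fun n => if (n <= size x)%N then take n x else iter (n - size x) h x); last first.
  by rewrite leqnn take_size.
split=> [|n|n]; first by rewrite /= take0.
- case: ltngtP => [nx|xn|].
  + have i0 : 'I_sigma by case: x nx {dx dit}.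
    by exists (nth i0 x n); rewrite (take_nth i0).
  + by rewrite subSn ?(ltnW xn)//=; have [] := hP _ (dit (n - size x)%N).
  + by move=> ->; rewrite subSnn/= take_size; have [] := hP _ dx.
- case: leqP => xn; last exact/deepC/dit.
  by apply/deepC/(@deep_cat _ _ (drop n x)) => //; rewrite cat_take_drop.
Qed.

(** Uniqueness of the infinite path, tested level by level: quantifying over vertices instead of
    paths keeps the condition countable. *)
Definition single_ray C := deep C [::] /\
  forall x y, size x = size y -> deep C x -> deep C y -> x = y.

Lemma exists_unique_rayP C : downward_closed C ->
  (exists! p, infinite_self_avoiding_path C p) <-> single_ray C.
Proof.
move=> dC; rewrite infinite_self_avoiding_pathE; split=> [[p [rp up]]|[d0 dU]].
  split; first by have := ray_deep 0%N rp; case: rp => ->.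
  move=> x y sxy /(ray_through dC)[px rx pxx] /(ray_through dC)[py ry pyy].
  by rewrite -pxx -pyy -(up _ rx) -(up _ ry) sxy.
have [p rp _] := ray_through dC d0; exists p; split=> // q rq.
by apply/funext => n; apply: dU; rewrite ?(ray_size rp) ?(ray_size rq)//; exact: ray_deep.
Qed.

Lemma backbone_ray C p : single_ray C -> downward_closed C -> ray C p -> backbone C = p.
Proof.
move=> sC dC rp; have /exists_unique_rayP-/(_ dC)[q uq] := sC.
have := @xgetPex _ (fun=> [::]) [set p | unique (infinite_self_avoiding_path C) p]
  (ex_intro _ q uq).
rewrite -/(backbone C) => -[rb]; apply.
by rewrite infinite_self_avoiding_pathE.
Qed.

Lemma single_ray_backbone C : single_ray C -> downward_closed C -> ray C (backbone C).
Proof.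
move=> sC dC; have [p rp _] := ray_through dC sC.1.
by rewrite (backbone_ray sC dC rp).
Qed.

(** Turns a value of a choice operator into countable conditions on [C], from which measurability of
    the backbone follows. The second alternative is the default value in the absence of a unique
    path. *)
Lemma backboneP C k x : downward_closed C -> backbone C k = x <->
  (single_ray C /\ size x = k /\ deep C x) \/ (~ single_ray C /\ x = [::]).
Proof.
move=> dC; have [sC|nsC] := pselect (single_ray C).
  have rb := single_ray_backbone sC dC.
  split=> [<-|[[_ [<- dx]]|[]//]].
    left; split=> //; split; [exact: ray_size rb k|exact: ray_deep].
  by apply: sC.2 => //; [exact: ray_size rb _|exact: ray_deep].
have -> : backbone C k = [::].
  rewrite /backbone xgetPN// => p up; apply: nsC; apply/exists_unique_rayP => //.
  by exists p.
split=> [<-|[[]//|[_ ->]]//]; by right.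
Qed.

End Rays.

(** * The invasion cluster of a fixed weight configuration *)

Lemma exists_argmin (R : realType) (T : eqType) (f : T -> R) (A : set T) (s : seq T) :
  A `<=` [set` s] -> A !=set0 -> exists2 m, A m & forall y, A y -> f m <= f y.
Proof.
elim: s A => [|a s IH] A As [b Ab]; first by have := As _ Ab.
have [[c [Ac ca]]|nA] := pselect (exists c, A c /\ c <> a); last first.
  have Aa c : A c -> c = a by move=> Ac; apply: contrapT => ca; apply: nA; exists c.
  by exists b => // y Ay; rewrite (Aa y)// (Aa b).
have [||m [Am ma] mP] := IH (A `\ a); last 1 first.
- have [/andP[/asboolP Aa am]|/negP nam] := boolP (`[< A a >] && (f a < f m)).
    exists a => // y Ay; have [->//|/eqP ya] := eqVneq y a.
    by rewrite (le_trans (ltW am))// mP.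
  exists m => // y Ay; have [ya|/eqP ya] := eqVneq y a; last exact: mP.
  rewrite leNgt; apply/negP => ym; apply: nam; rewrite -ya ym andbT.
  exact/asboolP.
- by move=> y [/As /=]; rewrite inE => /orP[/eqP->|].
- by exists c.
Qed.

Section Invasion.
Context (R : realType) (sigma : nat) (i0 : 'I_sigma) (w : edge sigma -> R).
Implicit Types (e f : edge sigma) (x y : vertex sigma) (p : R)
  (u : seq 'I_sigma) (v : nat -> vertex sigma).

Lemma invasion_root N : invasion w N [::].
Proof. by elim: N => // N IH; left. Qed.

Lemma invasion_downward_closed N : downward_closed (invasion w N).
Proof.
elim: N => [|N IH] x i; first by case: x.
case=> [/IH Ix|[e [be _] Ixi]]; first by left.
have Ie : invasion w N e.1.
  by case: be => -[//]; move=> _ /IH.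
case: Ixi => [xe|/rcons_inj[-> _]]; last by left.
by left; apply: (IH _ i); rewrite xe.
Qed.

Lemma boundary_invasion N e : boundary (invasion w N) e <->
  invasion w N e.1 /\ ~ invasion w N (child e).
Proof.
split=> [[//|[nI /invasion_downward_closed//]]|]; by left.
Qed.

Lemma invasion_size N x : invasion w N x -> (size x <= N)%N.
Proof.
elim: N x => [|N IH] x; first by move=> ->.
case=> [/IH/leqW//|[e [/boundary_invasion[/IH sN _] _]]].
by case=> ->; rewrite ?size_rcons// leqW.
Qed.

Fixpoint words n : seq (vertex sigma) :=
  if n is n'.+1 then [::] :: [seq i :: u | i <- enum 'I_sigma, u <- words n']
  else [:: [::]].

Lemma mem_words n x : (size x <= n)%N -> x \in words n.
Proof.
elim: n x => [|n IH] [|i x]//= sx; rewrite !inE/=.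
by apply/allpairsP; exists (i, x); rewrite mem_enum/= IH.
Qed.

Lemma finite_bounded_size (A : set (vertex sigma)) n :
  (forall x, A x -> (size x <= n)%N) -> finite_set A.
Proof.
move=> An; apply: (@sub_finite_set _ _ [set` words n]); last exact: finite_seq.
by move=> x /An/mem_words.
Qed.

Lemma exists_smallest_boundary_edge N :
  exists e, smallest_boundary_edge w (invasion w N) e.
Proof.
suff [e be eP] : exists2 e, boundary (invasion w N) e &
    forall f, boundary (invasion w N) f -> w e <= w f by exists e; split.
apply: (@exists_argmin _ _ _ _ [seq (x, i) | x <- words N, i <- enum 'I_sigma]).
  move=> [x i] /boundary_invasion[/= /invasion_size xN _].
  by apply/allpairsP; exists (x, i); rewrite mem_words ?mem_enum.
have [n nP nmax] : exists2 n, (exists2 x, invasion w N x & size x = n) &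
    forall x, invasion w N x -> (size x <= n)%N.
  have h : exists n, `[< exists2 x, invasion w N x & size x = n >].
    by exists 0%N; apply/asboolP; exists [::] => //; exact: invasion_root.
  case: (@ex_maxnP _ N h) => [n /asboolP[x /invasion_size + <-]//|n /asboolP nP nmax].
  by exists n => // x Ix; apply: nmax; apply/asboolP; exists x.
case: nP => x Ix xn; exists (x, i0); apply/boundary_invasion; split=> //.
by move=> /nmax; rewrite size_rcons xn ltnn.
Qed.

Lemma smallest_boundary_edge_ipc N e :
  smallest_boundary_edge w (invasion w N) e -> invasion w N.+1 (child e).
Proof. by move=> se; right; exists e => //; right. Qed.

Lemma ipc_downward_closed : downward_closed (ipc w).
Proof. by move=> x i [N _ /invasion_downward_closed Ix]; exists N. Qed.

Lemma ipc_edge e : ipc w (child e) ->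
  exists N, smallest_boundary_edge w (invasion w N) e.
Proof.
case=> N _; elim: N => [|N IH]; first by rewrite /child/=; case: e.1.
case=> [//|[f sf]]; have [/boundary_invasion[If _] _] := sf.
case=> [ef|]; first by apply: IH; rewrite ef.
case: e f sf {IH If} => [x i] [y j] sf /rcons_inj[-> ->]; by exists N.
Qed.

(** Each step adds a new vertex, but ties may add several, hence a list inside the invaded set and
    not an exact count. *)
Lemma invasion_card N :
  exists s : seq (vertex sigma), [/\ uniq s, size s = N.+1 & [set` s] `<=` invasion w N].
Proof.
elim: N => [|N [s [us ss sI]]]; first by exists [:: [::]]; split=> // x /=; rewrite inE => /eqP.
have [e se] := exists_smallest_boundary_edge N.
exists (child e :: s); split; rewrite /= ?ss// ?us ?andbT.
  by apply/negP => /sI; case: se => /boundary_invasion[].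
move=> x /=; rewrite inE => /orP[/eqP ->|/sI]; last by left.
exact: smallest_boundary_edge_ipc.
Qed.

(** An empty level n would confine the cluster to the finitely many words of length at most n,
    although N steps invade at least N + 1 vertices. *)
Lemma deep_ipc : deep (ipc w) [::].
Proof.
move=> n; apply: contrapT => nu.
have sn x : ipc w x -> (size x <= n)%N.
  move=> Cx; rewrite leqNgt; apply/negP => nx; apply: nu; exists (take n x).
    by rewrite size_takel// ltnW.
  apply: (@downward_closed_cat _ _ _ (drop n x) ipc_downward_closed).
  by rewrite cat_take_drop.
have [s [us ss sI]] := invasion_card (size (words n)).
suff : (size s <= size (words n))%N by rewrite ss ltnn.
by apply: uniq_leq_size => // x /sI Ix; apply/mem_words/sn; exists (size (words n)).
Qed.

(* The smallest p such that some path of length n.+1 descending through e has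
   all its weights at most p. *)
Fixpoint bottleneck_at n e : R :=
  if n is n'.+1 then
    Num.max (w e) (\big[Num.min/1]_(i < sigma) bottleneck_at n' (child e, i))
  else w e.

(** This is M(e): since the tree is finitely branching, compactness allows a supremum over depths in
    place of the infimum over infinite paths, and only finite minima have to be handled. *)
Definition bottleneck e : R := sup (range (bottleneck_at^~ e)).

Hypothesis w01 : forall e, 0 <= w e <= 1.

Lemma bottleneck_at01 n e : 0 <= bottleneck_at n e <= 1.
Proof.
elim: n e => [|n IH] e //=; have /andP[w0 w1] := w01 e.
rewrite le_max w0/= ge_max w1/=; apply: (@bigmin_inf _ _ _ _ i0) => //.
by have /andP[] := IH (child e, i0).
Qed.

Lemma has_ubound_bottleneck_at e : has_ubound (range (bottleneck_at^~ e)).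
Proof. by exists 1 => _ [n _ <-]; have /andP[] := bottleneck_at01 n e. Qed.

Lemma bottleneck_at_le n e : bottleneck_at n e <= bottleneck e.
Proof. by apply: ub_le_sup; [exact: has_ubound_bottleneck_at|exists n]. Qed.

Lemma bottleneck_le e p : (forall n, bottleneck_at n e <= p) -> bottleneck e <= p.
Proof.
by move=> h; apply: ge_sup => [|_ [n _ <-]//]; exists (bottleneck_at 0 e), 0%N.
Qed.

Lemma bottleneck01 e : 0 <= bottleneck e <= 1.
Proof.
rewrite (le_trans _ (bottleneck_at_le 0 e)) /=; last by have /andP[] := w01 e.
by apply: bottleneck_le => n; have /andP[] := bottleneck_at01 n e.
Qed.

Lemma bottleneck_atS_le n e p : bottleneck_at n.+1 e <= p <->
  w e <= p /\ exists i, bottleneck_at n (child e, i) <= p.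
Proof.
rewrite /= ge_max; split=> [/andP[-> h]|[-> [i h]]].
  (* The initial value 1 of the minimum is harmless: all entries are at most 1 and [i0] provides at
     least one, so some child attains the minimum. *)
  split=> //; have [i _ h'] := @eq_bigmin _ _ _ 1 i0 xpredT
    (fun i => bottleneck_at n (child e, i)) isT
    (fun i _ => proj2 (andP (bottleneck_at01 n (child e, i)))).
  by exists i; rewrite -h'.
by apply/andP; split=> //; exact: (bigmin_inf i).
Qed.

Lemma bottleneck_at_leP n e p : bottleneck_at n e <= p <->
  exists2 u, size u = n & open_below (fun f => w f <= p) e u.
Proof.
elim: n e => [|n IH] e.
  split=> [h|[u /size0nil -> /=]]; last by rewrite andbT.
  by exists [::] => //=; rewrite h.
split=> [/bottleneck_atS_le[we [i /IH [u su ou]]]|].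
  by exists (i :: u); rewrite /= ?su// we.
case=> -[|i u]//= [su] /andP[we ou].
by apply/bottleneck_atS_le; split=> //; exists i; apply/IH; exists u.
Qed.

Lemma bottleneck_child e i : bottleneck e <= Num.max (w e) (bottleneck (child e, i)).
Proof.
apply: bottleneck_le => -[|n]; first by rewrite /= le_max lexx.
apply/bottleneck_atS_le; split; first by rewrite le_max lexx.
by exists i; rewrite le_max bottleneck_at_le orbT.
Qed.

(** If [bottleneck e <= p], open paths of every length descend through [e]. Otherwise
    [p < bottleneck_at n e] for some n, and the cluster stops within n levels below [e.1]. Equality
    falls on the infinite side, whence the strict inequality. *)
Lemma finite_open_cluster e p :
  finite_set (open_cluster (fun f => w f <= p) (branch e) e.1) <-> p < bottleneck e.
Proof.
split=> [fK|pe].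
  rewrite ltNge; apply/negP => ep.
  have /finite_seqP[s sE] := fK.
  pose n := \max_(x <- s) size x.
  have : bottleneck_at n e <= p by rewrite (le_trans (bottleneck_at_le n e)).
  move=> /bottleneck_at_leP[u su ou].
  have : [set` s] (child e ++ u) by rewrite -sE; apply/open_clusterP; right; exists u.
  move=> /= /(@leq_bigmax_seq _ _ _ (size : vertex sigma -> nat))-/(_ xpredT isT).
  by rewrite -/n size_cat size_rcons su; lia.
have [n pn] : exists n, p < bottleneck_at n e.
  apply: contrapT => /forallNP h; suff : bottleneck e <= p by rewrite leNgt pe.
  by apply: bottleneck_le => n; rewrite leNgt; apply/negP.
apply: (@finite_bounded_size _ (size e.1 + n)%N) => x /open_clusterP[->|[u -> ou]].
  exact: leq_addr.
rewrite size_cat size_rcons addSn -addnS leq_add2l ltnNge; apply/negP => nu.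
suff : bottleneck_at n e <= p by rewrite leNgt pn.
apply/bottleneck_at_leP; exists (take n u); first by rewrite size_takel.
by apply: (@open_below_cat _ _ _ _ (drop n u)); rewrite cat_take_drop.
Qed.

Lemma open_below_boundary (op : edge sigma -> bool) N e u : open_below op e u ->
  invasion w N e.1 -> ~ invasion w N (child e ++ u) ->
  exists2 f, op f & boundary (invasion w N) f.
Proof.
elim: u e => [|i u IH] e /= /andP[oe ou] Ie nI.
  by exists e => //; apply/boundary_invasion; rewrite cats0 in nI.
have [Ic|nIc] := pselect (invasion w N (child e)).
  by apply: (IH (child e, i)) => //; rewrite child_cat.
by exists e => //; apply/boundary_invasion.
Qed.

(* While the invasion is in progress below x, a path of edges of weight at most
   bottleneck (x, i) leaves the finite invaded region through its boundary. *)
Lemma ipc_weight_le x i f : prefix x f.1 -> ipc w (child f) -> w f <= bottleneck (x, i).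
Proof.
move=> /prefixP[u xu] /ipc_edge[N sf]; have [/boundary_invasion[If _] fP] := sf.
rewrite xu in If; have Ix := downward_closed_cat (@invasion_downward_closed N) If.
have := bottleneck_at_le N (x, i); set q := bottleneck_at _ _ => qle.
have /bottleneck_at_leP[t st ot] : bottleneck_at N (x, i) <= q by [].
have [|g wg bg] := open_below_boundary ot Ix.
  by move=> /invasion_size; rewrite size_cat size_rcons st; lia.
exact: le_trans (fP _ bg) (le_trans wg qle).
Qed.

Lemma parent_weight_child e : parent_weight w (child e) = w e.
Proof.
case: e => -[|j x] i //; rewrite /parent_weight /child/=.
by rewrite belast_rcons last_rcons.
Qed.

Section RayWeights.
Variable v : nat -> vertex sigma.
Hypothesis rv : ray (ipc w) v.

(** Used also for children [j] off the ray, where it forces the ray into a direction of minimal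
    bottleneck. *)
Lemma ray_weight_le k l j : (k < l)%N -> parent_weight w (v l) <= bottleneck (v k, j).
Proof.
case: l => // l; rewrite ltnS => kl; case: (rv) => _ s Cv; have [i vl] := s l.
have := parent_weight_child (v l, i); rewrite /child/= -vl => ->.
apply: ipc_weight_le; last by rewrite /child -vl.
by apply/prefixP; exists (drop k (v l)); rewrite -(ray_take rv kl) cat_take_drop.
Qed.

(** Initial segments of the ray compete in every [bottleneck_at n], so the bottleneck is at most the
    supremum of the weights along the ray; the other inequality is [ray_weight_le] in the direction
    of the ray. *)
Lemma ray_sup k i : v k.+1 = rcons (v k) i ->
  sup [set parent_weight w (v l) | l in [set l | (k < l)%N]] = bottleneck (v k, i).
Proof.
move=> vk; set S := [set _ | _ in _].
have S0 : S !=set0 by exists (parent_weight w (v k.+1)), k.+1 => /=.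
have Sub : has_ubound S by exists (bottleneck (v k, i)) => _ [l kl <-]; exact: ray_weight_le.
apply/eqP; rewrite eq_le; apply/andP; split.
  by apply: ge_sup => // _ [l kl <-]; exact: ray_weight_le.
apply: bottleneck_le => n; apply/bottleneck_at_leP.
suff [u [su _ ou]] : exists u, [/\ size u = n, v (k.+1 + n)%N = child (v k, i) ++ u &
    open_below (fun f => w f <= sup S) (v k, i) u] by exists u.
elim: n => [|n [u [su vu ou]]].
  exists [::]; rewrite addn0 cats0 vk /= andbT; split=> //.
  apply: ub_le_sup => //; exists k.+1 => //=.
  by rewrite -(parent_weight_child (v k, i)) vk.
case: (rv) => _ s _; have [j vj] := s (k.+1 + n)%N.
exists (rcons u j); rewrite size_rcons su addnS vj vu rcons_cat; split=> //.
rewrite open_below_rcons ou/=; apply: ub_le_sup => //; exists (k.+1 + n).+1.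
  by rewrite /=; lia.
by rewrite -parent_weight_child vj vu.
Qed.

Lemma bottleneck_ray_le k i j : v k.+1 = rcons (v k) i ->
  bottleneck (v k, i) <= bottleneck (v k, j).
Proof.
move=> /ray_sup <-; apply: ge_sup; first by exists (parent_weight w (v k.+1)), k.+1 => /=.
by move=> _ [l kl <-]; exact: ray_weight_le.
Qed.

End RayWeights.

(** The first clause excludes ties between directions and makes the infinite path unique. The second
    turns weights at most [W_k] into weights strictly below [W_k] in the branches off the
    backbone. *)
Definition generic :=
  (forall x i j, i <> j -> bottleneck (x, i) <> bottleneck (x, j)) /\
  (forall x i j f, i <> j -> prefix (rcons x i) (child f) -> w f <> bottleneck (x, j)).

Hypothesis gw : generic.

(** At the vertex where two infinite paths separate, both directions would have minimal bottleneck,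
    which is a tie. *)
Lemma single_ray_ipc : single_ray (ipc w).
Proof.
have dC := ipc_downward_closed; split; first exact: deep_ipc.
suff H n x y : size x = n -> size y = n -> deep (ipc w) x -> deep (ipc w) y -> x = y.
  by move=> x y sxy; apply: H => //; rewrite sxy.
elim: n x y => [|n IH] x y; first by move=> /size0nil -> /size0nil ->.
case: (lastP x) => // {}x i; case: (lastP y) => // {}y j.
rewrite !size_rcons => -[sx] [sy] dx dy.
have xy : y = x by apply: IH => //; exact: deep_rcons dC (_ : deep _ (rcons _ _)).
subst y; congr rcons; apply: contrapT => ij; apply: (gw.1 x i j ij).
have [p rp] := ray_through dC dx; have [q rq] := ray_through dC dy.
rewrite !size_rcons sx => qx px.
have pn : p n = x by rewrite -(ray_take rp (leqnSn n)) px -sx -cats1 take_size_cat.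
have qn : q n = x by rewrite -(ray_take rq (leqnSn n)) qx -sx -cats1 take_size_cat.
have := @bottleneck_ray_le _ rp n i j; rewrite px pn => /(_ erefl) ij1.
have := @bottleneck_ray_le _ rq n j i; rewrite qx qn => /(_ erefl) ij2.
by apply/eqP; rewrite eq_le ij1 ij2.
Qed.

Lemma ray_backbone_ipc : ray (ipc w) (backbone (ipc w)).
Proof. exact: single_ray_backbone single_ray_ipc ipc_downward_closed. Qed.

Let v := backbone (ipc w).

Lemma max_future_weightE k i : v k.+1 = rcons (v k) i ->
  max_future_weight w k = bottleneck (v k, i).
Proof. exact: (ray_sup ray_backbone_ipc). Qed.

Lemma max_future_weight01 k : 0 <= max_future_weight w k <= 1.
Proof.
case: ray_backbone_ipc => _ /(_ k)[i] vk _.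
by rewrite (max_future_weightE vk); exact: bottleneck01.
Qed.

(* Weights along the backbone after height k come arbitrarily close to W_k, and
   when an edge of weight q is invaded, everything connected to the invaded
   region by weights below q has been invaded before. *)
Lemma ipc_branch e : off_backbone w e ->
  ipc w `&` [set` branch e] =
  open_cluster (fun f => w f <= max_future_weight w (size e.1)) (branch e) e.1.
Proof.
move=> oe; have [ve nve] : v (size e.1) = e.1 /\ v (size e.1).+1 <> child e := oe.
set k := size e.1 in ve nve *.
have rv : ray (ipc w) v := ray_backbone_ipc; case: (rv) => _ /(_ k)[i] vk Cv.
have ie : i <> e.2.
  by move=> ie; apply: nve; rewrite vk ve ie.
have WE := max_future_weightE vk; rewrite [v k]ve in WE.
apply/seteqP; split=> [x /= [Cx]|x /open_clusterP[->|[u -> ou]]].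
- rewrite inE => /orP[/eqP ->|/prefixP[u xu]]; first by apply/open_clusterP; left.
  apply/open_clusterP; right; exists u => //; rewrite {x}xu in Cx.
  rewrite WE; elim/last_ind: u Cx => [|u j IH] Cx.
    rewrite cats0 in Cx; rewrite /= andbT.
    by apply: ipc_weight_le => //; exact: prefix_refl.
  rewrite -rcons_cat in Cx; rewrite open_below_rcons IH/=; last exact: ipc_downward_closed Cx.
  apply: ipc_weight_le => //=; rewrite /child cat_rcons; exact: prefix_prefix.
- by split; [rewrite -ve; exact: Cv|apply/orP; left].
- split; last by apply/orP; right; exact: prefix_prefix.
  have ltW : forall q, (forall l, (k < l)%N -> parent_weight w (v l) <= q) -> max_future_weight w k <= q.
    move=> q hq; apply: ge_sup; first by exists (parent_weight w (v k.+1)), k.+1 => /=.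
    by move=> _ [l kl <-]; exact: hq.
  (* Genericity keeps the finitely many weights along [u] different from [W_k], hence strictly below
     it; their maximum [q] is then exceeded by some later backbone weight. *)
  have out : exists2 q, q < max_future_weight w k & open_below (fun f => w f <= q) e u.
    have : open_below (fun f => w f < max_future_weight w k) e u.
      elim/last_ind: u ou => [|u j IH].
        rewrite /= !andbT lt_neqAle => ->; rewrite andbT WE; apply/eqP.
        apply: gw.2; first by apply: nesym; exact: ie.
        by rewrite -/(child (e.1, e.2)) -surjective_pairing; exact: prefix_refl.
      rewrite !open_below_rcons => /andP[/IH -> /=]; rewrite lt_neqAle => ->.
      rewrite andbT WE; apply/eqP; apply: gw.2; first by apply: nesym; exact: ie.
      rewrite -/(child (e.1, e.2)) -surjective_pairing /child rcons_cat.
      exact: prefix_prefix.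
    elim/last_ind: u {ou} => [/=|u j IH].
      by rewrite andbT => we; exists (w e) => //=; rewrite lexx.
    rewrite open_below_rcons => /andP[/IH[q qW oq] wj].
    exists (Num.max q (w (child e ++ u, j))); first by rewrite gt_max qW.
    rewrite open_below_rcons le_max lexx orbT andbT.
    by apply: sub_open_below oq => f wf; rewrite le_max wf.
  have {out}[q qW oq] := out.
  have [l kl ql] : exists2 l, (k <= l)%N & q < parent_weight w (v l.+1).
    apply: contrapT => nl; suff : max_future_weight w k <= q by rewrite leNgt qW.
    apply: ltW => -[//|l] kl; rewrite leNgt; apply/negP => ql; apply: nl.
    by exists l.
  case: (rv) => _ /(_ l)[j] vl _.
  have /ipc_edge[N sN] : ipc w (child (v l, j)) by rewrite /child -vl; exact: Cv.
  have [/boundary_invasion[/= Ivl _] min] := sN.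
  have Ie : invasion w N e.1.
    apply: (@downward_closed_cat _ _ _ (drop k (v l)) (@invasion_downward_closed N)).
    by rewrite -ve -(ray_take rv kl) cat_take_drop.
  apply: contrapT => nC; have [|f wf bf] := open_below_boundary oq Ie.
    by move=> Iu; apply: nC; exists N.
  have := min _ bf; rewrite -parent_weight_child /child/= -vl => /(le_trans)/(_ wf).
  by rewrite leNgt ql.
Qed.

Definition path_edge x k : edge sigma := (take k x, nth i0 x k).

Lemma child_path_edge x k : (k < size x)%N -> child (path_edge x k) = take k.+1 x.
Proof. by move=> kx; rewrite /child /= -take_nth. Qed.

(** Edges starting at [x] itself are excluded: the path to [x] does not decide which child of [x]
    the backbone takes. *)
Definition off_path x f :=
  [&& (size f.1 < size x)%N, f.1 == take (size f.1) x
    & child f != take (size f.1).+1 x].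

(* W_k on the event that the backbone passes through x; unlike bottleneck, it
   does not depend on the branches leaving the path from the root to x. *)
Definition path_threshold x k : R :=
  \big[Num.max/bottleneck (path_edge x (size x).-1)]_(k <= l < (size x).-1)
    w (path_edge x l).

Lemma path_threshold_ltn x k : (k < (size x).-1)%N ->
  path_threshold x k = Num.max (w (path_edge x k)) (path_threshold x k.+1).
Proof. by move=> kx; rewrite /path_threshold big_ltn. Qed.

Lemma path_threshold_last x : path_threshold x (size x).-1 = bottleneck (path_edge x (size x).-1).
Proof. by rewrite /path_threshold big_geq. Qed.

Lemma path_threshold_ind x (P : nat -> Prop) : P (size x).-1 ->
  (forall k, (k < (size x).-1)%N -> P k.+1 -> P k) ->
  forall k, (k < size x)%N -> P k.
Proof.
move=> P0 PS k kx; have : (k <= (size x).-1)%N by lia.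
move=> /subnKC; move: (_ - _)%N => d; elim: d k {kx} => [|d IH] k.
  by rewrite addn0 => ->.
by rewrite addnS => h; apply: PS; [lia|apply: IH; lia].
Qed.

(** Following [x] and continuing optimally through its last edge is one candidate in the minimum
    behind the bottleneck, wherever the backbone may run. *)
Lemma bottleneck_path_threshold x k : (k < size x)%N ->
  bottleneck (path_edge x k) <= path_threshold x k.
Proof.
apply: (@path_threshold_ind x (fun k => bottleneck (path_edge x k) <= path_threshold x k)).
  by rewrite path_threshold_last.
move=> {}k kx IH; rewrite path_threshold_ltn//.
apply: le_trans (bottleneck_child _ (nth i0 x k.+1)) _.
rewrite ge_max !le_max lexx/=; apply/orP; right.
by rewrite child_path_edge//; lia.
Qed.

(** The path edges are invaded, so each has weight at most the bottleneck at its height, which is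
    [W] there; as [W] does not increase with the height, downward induction bounds the threshold by
    [W_k]. *)
Lemma path_threshold_backbone x k : v (size x) = x -> (k < size x)%N ->
  max_future_weight w k = path_threshold x k.
Proof.
have rv : ray (ipc w) v := ray_backbone_ipc; case: (rv) => _ s Cv.
move=> vx kx.
have vk l : (l <= size x)%N -> v l = take l x by move=> lx; rewrite -vx (ray_take rv lx).
have WE l : (l < size x)%N -> max_future_weight w l = bottleneck (path_edge x l).
  move=> lx; have vl : v l.+1 = rcons (v l) (nth i0 x l).
    by rewrite !vk// ?(ltnW lx)//; exact: take_nth.
  by rewrite (max_future_weightE vl) vk// ltnW.
apply/eqP; rewrite eq_le WE//= bottleneck_path_threshold//=.
rewrite -WE//; apply: (@path_threshold_ind x
  (fun k => path_threshold x k <= max_future_weight w k)) => //.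
  by rewrite path_threshold_last WE//; lia.
move=> l lx IH; have lx' : (l < size x)%N by lia.
rewrite path_threshold_ltn// ge_max WE//; apply/andP; split.
  by apply: ipc_weight_le; [exact: prefix_refl|rewrite child_path_edge// -vk//; exact: Cv].
apply: le_trans IH _; rewrite -WE//; apply: ge_sup.
  by exists (backbone_weight w l.+2), l.+2 => /=.
move=> _ [n /= ln <-]; have [i vl] := s l.
by rewrite (max_future_weightE vl); apply: (ray_weight_le rv) => //; lia.
Qed.

Lemma off_backboneE x f : v (size x) = x -> (size f.1 < size x)%N ->
  off_backbone w f <-> off_path x f.
Proof.
have rv : ray (ipc w) v := ray_backbone_ipc => vx fx; rewrite /off_path fx/=.
have vk l : (l <= size x)%N -> v l = take l x by move=> lx; rewrite -vx (ray_take rv lx).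
rewrite /off_backbone -/v !vk// 1?ltnW//; split=> [[h /eqP]|/andP[/eqP h /eqP cf]].
  by rewrite h eqxx eq_sym.
by split; [rewrite -h|exact: nesym].
Qed.

(** A backbone following [x] has minimal bottlenecks, and genericity makes the inequality strict. If
    it left the path at height k, its direction would have a bottleneck at most that of the path
    edge, hence at most the threshold, against the condition. *)
Lemma backbone_pathP x : v (size x) = x <->
  forall f, off_path x f -> path_threshold x (size f.1) < bottleneck f.
Proof.
have rv : ray (ipc w) v := ray_backbone_ipc; case: (rv) => v0 s Cv; split=> [vx [y j] /= /and3P[/= yx]|H].
  move=> /eqP yE cf; rewrite -(path_threshold_backbone vx yx).
  have vl l : (l <= size x)%N -> v l = take l x by move=> lx; rewrite -vx (ray_take rv lx).
  set k := size y in yx yE cf *; have vk : v k = y by rewrite vl// ltnW.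
  have [i vi] := s k; rewrite (max_future_weightE vi) vk lt_neqAle; apply/andP; split; last first.
    by rewrite -vk; exact: bottleneck_ray_le vi.
  apply/eqP; apply: gw.1 => ij; move/eqP: cf; apply.
  rewrite /child/= -ij; transitivity (v k.+1); [by rewrite -vk; exact: esym vi|exact: vl].
suff vk k : (k <= size x)%N -> v k = take k x by rewrite vk// take_size.
elim: k => [|k IH] kx; first by rewrite take0; exact: v0.
have [i vi] := s k; apply: contrapT => vk; rewrite vi IH ?(ltnW kx)// in vk.
have sk : size (take k x) = k by rewrite size_takel// ltnW.
have : off_path x (take k x, i) by rewrite /off_path/= sk kx eqxx/=; apply/eqP.
move=> /H/=; rewrite sk ltNge => /negP; apply.
have := bottleneck_ray_le rv (nth i0 x k) vi; rewrite IH ?(ltnW kx)// => /le_trans; apply.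
exact: bottleneck_path_threshold.
Qed.

End Invasion.

(** * Measurability *)

Section MeasurablePredicates.
Context {d : measure_display} {X : measurableType d}.
Implicit Types P Q : X -> Prop.

Lemma measurable_ex (I : countType) (P : I -> X -> Prop) :
  (forall i, measurable [set t | P i t]) -> measurable [set t | exists i, P i t].
Proof.
move=> mP; rewrite [X in measurable X](_ : _ = \bigcup_i [set t | P i t]).
  exact: countable_bigcupT_measurable.
by apply/seteqP; split=> t [i]; [exists i|exists i].
Qed.

Lemma measurable_not P : measurable [set t | P t] -> measurable [set t | ~ P t].
Proof. exact: measurableC. Qed.

Lemma measurable_conj P Q : measurable [set t | P t] -> measurable [set t | Q t] ->
  measurable [set t | P t /\ Q t].
Proof. exact: measurableI. Qed.

Lemma measurable_disj P Q : measurable [set t | P t] -> measurable [set t | Q t] ->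
  measurable [set t | P t \/ Q t].
Proof. exact: measurableU. Qed.

Lemma measurable_const (p : Prop) : measurable [set _ : X | p].
Proof.
have [hp|np] := pselect p.
  by rewrite [X in measurable X](_ : _ = setT)//; apply/seteqP; split.
by rewrite [X in measurable X](_ : _ = set0)//; apply/seteqP; split.
Qed.

Lemma measurable_imp P Q : measurable [set t | P t] -> measurable [set t | Q t] ->
  measurable [set t | P t -> Q t].
Proof.
move=> mP mQ; rewrite [X in measurable X](_ : _ = [set t | ~ P t \/ Q t]).
  by apply: measurable_disj => //; exact: measurable_not.
apply/seteqP; split=> t /=; last by tauto.
by move=> h; have [/h|] := pselect (P t); [right|left].
Qed.

Lemma measurable_all (I : countType) (P : I -> X -> Prop) :
  (forall i, measurable [set t | P i t]) -> measurable [set t | forall i, P i t].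
Proof.
move=> mP; rewrite [X in measurable X](_ : _ = [set t | ~ exists i, ~ P i t]).
  by apply/measurable_not/measurable_ex => i; exact: measurable_not.
apply/seteqP; split=> t /=; first by move=> h [i]; apply.
by move=> /forallNP h i; apply: contrapT; exact: h.
Qed.

Lemma measurable_bool (b : X -> bool) : measurable_fun setT b -> measurable [set t | b t].
Proof. by move=> mb; rewrite -[X in measurable X]setTI; exact: mb. Qed.

Lemma measurable_le (R : realType) (f g : X -> R) : measurable_fun setT f ->
  measurable_fun setT g -> measurable [set t | f t <= g t].
Proof. by move=> mf mg; apply: measurable_bool; exact: measurable_fun_ler. Qed.

Lemma measurable_lt (R : realType) (f g : X -> R) : measurable_fun setT f ->
  measurable_fun setT g -> measurable [set t | f t < g t].
Proof. by move=> mf mg; apply: measurable_bool; exact: measurable_fun_ltr. Qed.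

Lemma measurable_eq (R : realType) (f g : X -> R) : measurable_fun setT f ->
  measurable_fun setT g -> measurable [set t | f t = g t].
Proof.
move=> mf mg; rewrite [X in measurable X](_ : _ = [set t | f t <= g t /\ g t <= f t]).
  by apply: measurable_conj; exact: measurable_le.
apply/seteqP; split=> t /=; first by move=> ->.
by move=> [fg gf]; apply/eqP; rewrite eq_le fg gf.
Qed.

Lemma measurable_preimage d' (Y : measurableType d') (f : X -> Y) (B : set Y) :
  measurable_fun setT f -> measurable B -> measurable [set t | B (f t)].
Proof. by move=> mf mB; rewrite -[X in measurable X]setTI; exact: mf. Qed.

End MeasurablePredicates.

Section MeasurableSubgraphs.
Context {d : measure_display} {X : measurableType d} (sigma : nat).
Variable S : X -> set (vertex sigma).
Hypothesis mS : forall x, measurable [set t | S t x].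

Lemma measurable_cluster_event A : cluster_event A -> measurable [set t | A (S t)].
Proof.
suff : @cluster_event sigma `<=` [set A | measurable [set t | A (S t)]] by apply.
apply: smallest_sub => [|_ [x ->]]; last exact: mS.
split=> [|B mB|F mF] /=.
- exact: measurable0.
- rewrite [X in _ X](_ : _ = ~` [set t | B (S t)]); first exact: measurableC.
  by apply/seteqP; split=> t /=; [case|].
- rewrite [X in _ X](_ : _ = [set t | exists i, F i (S t)]); first exact: measurable_ex.
  by apply/seteqP; split=> t [i]; exists i.
Qed.

(** [D] can be an arbitrary family because there are only countably many finite sets of vertices. *)
Lemma measurable_finite_subgraph (D : set (set (vertex sigma))) :
  measurable [set t | finite_set (S t) /\ D (S t)].
Proof.
rewrite [X in measurable X](_ : _ = [set t | exists s : seq (vertex sigma),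
    D [set` s] /\ forall x, (S t x -> x \in s) /\ (x \in s -> S t x)]).
  apply: measurable_ex => s; apply: measurable_conj; first exact: measurable_const.
  apply: measurable_all => x; apply: measurable_conj; apply: measurable_imp => //.
    exact: measurable_const.
  exact: measurable_const.
apply/seteqP; split=> t /=.
  by move=> [/finite_seqP[s sE] DS]; exists s; rewrite -sE; split=> // x; rewrite sE.
move=> [s [Ds sS]]; suff -> : S t = [set` s] by split=> //; exact: finite_seq.
by apply/seteqP; split=> x; have [] := sS x.
Qed.

Hypothesis dS : forall t, downward_closed (S t).

Lemma measurable_deep x : measurable [set t | deep (S t) x].
Proof.
apply: measurable_all => n.
rewrite [X in measurable X](_ : _ = [set t | exists u : seq 'I_sigma, size u = n /\ S t (x ++ u)]).
  by apply: measurable_ex => u; apply: measurable_conj => //; exact: measurable_const.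
by apply/seteqP; split=> t [u]; [exists u|case; exists u].
Qed.

Lemma measurable_single_ray : measurable [set t | single_ray (S t)].
Proof.
apply: measurable_conj; first exact: measurable_deep.
apply: measurable_all => x; apply: measurable_all => y.
apply: measurable_imp; first exact: measurable_const.
apply: measurable_imp; first exact: measurable_deep.
by apply: measurable_imp; [exact: measurable_deep|exact: measurable_const].
Qed.

Lemma measurable_backbone k x : measurable [set t | backbone (S t) k = x].
Proof.
rewrite [X in measurable X](_ : _ = [set t | (single_ray (S t) /\ size x = k /\ deep (S t) x) \/
   (~ single_ray (S t) /\ x = [::])]).
  apply: measurable_disj; apply: measurable_conj.
  - exact: measurable_single_ray.
  - by apply: measurable_conj; [exact: measurable_const|exact: measurable_deep].
  - exact/measurable_not/measurable_single_ray.
  - exact: measurable_const.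
by apply/seteqP; split=> t /=; move/(@backboneP _ _ _ _ (@dS t)).
Qed.

End MeasurableSubgraphs.

Section MeasurableInvasion.
Context {d : measure_display} {X : measurableType d} (R : realType) (sigma : nat).
Variable w : X -> edge sigma -> R.
Hypothesis mw : forall e, measurable_fun setT (w ^~ e).

Lemma measurable_invasion N x : measurable [set t | invasion (w t) N x].
Proof.
elim: N x => [|N IH] x; first exact: measurable_const.
have mb (e : edge sigma) : measurable [set t | boundary (invasion (w t) N) e].
  by apply: measurable_disj; apply: measurable_conj => //; exact: measurable_not.
apply: measurable_disj => //.
rewrite [X in measurable X](_ : _ = [set t | exists e : edge sigma,
   (boundary (invasion (w t) N) e /\ forall f : edge sigma,
     boundary (invasion (w t) N) f -> w t e <= w t f) /\ (x = e.1 \/ x = child e)]).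
  apply: measurable_ex => e; apply: measurable_conj; last exact: measurable_const.
  apply: measurable_conj => //; apply: measurable_all => f.
  by apply: measurable_imp => //; exact: measurable_le.
apply/seteqP; split=> t /=.
  by move=> [e se xe]; exists e; split.
by move=> [e [se xe]]; exists e.
Qed.

Lemma measurable_ipc x : measurable [set t | ipc (w t) x].
Proof.
rewrite [X in measurable X](_ : _ = [set t | exists N, invasion (w t) N x]).
  by apply: measurable_ex => N; exact: measurable_invasion.
by apply/seteqP; split=> t [N]; exists N.
Qed.

Lemma measurable_backbone_ipc k x : measurable [set t | backbone (ipc (w t)) k = x].
Proof.
by apply: measurable_backbone => [y|t]; [exact: measurable_ipc|exact: ipc_downward_closed].
Qed.

Lemma measurable_parent_weight x : measurable_fun setT (fun t => parent_weight (w t) x).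
Proof. by case: x => [|i u] /=; [exact: measurable_cst|exact: mw]. Qed.

Lemma measurable_backbone_weight l : measurable_fun setT (fun t => backbone_weight (w t) l).
Proof.
move=> _ B mB; rewrite setTI.
rewrite [X in measurable X](_ : _ = [set t | exists x, backbone (ipc (w t)) l = x /\
   B (parent_weight (w t) x)]).
  apply: measurable_ex => x; apply: measurable_conj; first exact: measurable_backbone_ipc.
  by apply: measurable_preimage => //; exact: measurable_parent_weight.
apply/seteqP; split=> t /=.
  by move=> Bt; exists (backbone (ipc (w t)) l).
by move=> [x [<-]].
Qed.

Lemma measurable_max_future_weight k : measurable_fun setT (fun t => max_future_weight (w t) k).
Proof.
pose S t := [set backbone_weight (w t) l | l in [set l | (k < l)%N]].
have S0 t : S t !=set0 by exists (backbone_weight (w t) k.+1), k.+1 => /=.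
rewrite [X in measurable_fun _ X](_ : _ = fun t =>
  fine (esups (fun l => (backbone_weight (w t) l)%:E) k.+1)).
  apply: measurableT_comp => //.
  apply: (@measurable_fun_esups _ _ _ _ (fun l t => (backbone_weight (w t) l)%:E)) => l.
  by apply/measurable_EFinP; exact: measurable_backbone_weight.
apply/funext => t.
have -> : esups (fun l => (backbone_weight (w t) l)%:E) k.+1 = ereal_sup (EFin @` S t).
  congr ereal_sup; apply/seteqP; split=> r [].
    by move=> l /= kl <-; exists (backbone_weight (w t) l) => //; exists l.
  by move=> _ [l kl <-] <-; exists l.
rewrite /max_future_weight -/(S t).
have [ub|nub] := pselect (has_ubound (S t)); first by rewrite ereal_sup_EFin.
(* For an unbounded set both sides are 0: [sup] by its default value, and [fine] at [+oo]. *)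
rewrite sup_out; last by case.
suff -> : ereal_sup (EFin @` S t) = +oo%E by [].
apply/eqyP => r r0; rewrite leNgt; apply/negP => supr; apply: nub.
exists r => y Sy; rewrite -lee_fin (le_trans _ (ltW supr))//.
by apply: ereal_sup_ubound; exists y.
Qed.

Lemma measurable_off_backbone e : measurable [set t | off_backbone (w t) e].
Proof.
apply: measurable_conj; first exact: measurable_backbone_ipc.
by apply: measurable_not; exact: measurable_backbone_ipc.
Qed.

End MeasurableInvasion.

Section MeasurableBranches.
Context {d : measure_display} {X : measurableType d} (R : realType) (sigma : nat).

(** Measurability is required only for edges below [e], so that the result applies to the
    sigma-algebra generated by the weights of a single branch. *)
Lemma measurable_open_below (op : X -> edge sigma -> bool) e (u : seq 'I_sigma) :
  (forall f, prefix (child e) (child f) -> measurable [set t | op t f]) ->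
  measurable [set t | open_below (op t) e u].
Proof.
elim: u e => [|i u IH] e mop /=.
  rewrite [X in measurable X](_ : _ = [set t | op t e]).
    by apply: mop; exact: prefix_refl.
  by apply/seteqP; split=> t /=; rewrite andbT.
rewrite [X in measurable X](_ : _ = [set t | op t e /\ open_below (op t) (child e, i) u]).
  apply: measurable_conj; first by apply: mop; exact: prefix_refl.
  apply: IH => f /prefixP[v vf]; apply: mop; apply/prefixP; exists (i :: v).
  by rewrite vf /child cat_rcons.
by apply/seteqP; split=> t /=; [move=> /andP[]|move=> [-> ->]].
Qed.

Lemma measurable_finite_open_cluster (op : X -> edge sigma -> bool) e
    (D : set (set (vertex sigma))) :
  (forall f, prefix (child e) (child f) -> measurable [set t | op t f]) ->
  measurable [set t | finite_set (open_cluster (op t) (branch e) e.1) /\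
                      D (open_cluster (op t) (branch e) e.1)].
Proof.
move=> mop; apply: (@measurable_finite_subgraph _ _ _
  (fun t => open_cluster (op t) (branch e) e.1)) => x.
rewrite [X in measurable X](_ : _ = [set t | x = e.1 \/
   exists u : seq 'I_sigma, x = child e ++ u /\ open_below (op t) e u]).
  apply: measurable_disj; first exact: measurable_const.
  apply: measurable_ex => u; apply: measurable_conj; first exact: measurable_const.
  exact: measurable_open_below.
apply/seteqP; split=> t /=; rewrite open_clusterP.
  by case=> [->|[u]]; [left|right; exists u].
by case=> [->|[u []]]; [left|right; exists u].
Qed.

Lemma measurable_bigmin (I : Type) (s : seq I) (F : I -> X -> R) (c : R) :
  (forall i, measurable_fun setT (F i)) ->
  measurable_fun setT (fun t => \big[Num.min/c]_(i <- s) F i t).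
Proof.
move=> mF; elim: s => [|i s IH].
  by under eq_fun do rewrite big_nil; exact: measurable_cst.
by under eq_fun do rewrite big_cons; exact: measurable_minr.
Qed.

Lemma measurable_bigmax (I : eqType) (s : seq I) (F : I -> X -> R) (c : X -> R) :
  measurable_fun setT c -> (forall i, i \in s -> measurable_fun setT (F i)) ->
  measurable_fun setT (fun t => \big[Num.max/c t]_(i <- s) F i t).
Proof.
move=> mc; elim: s => [|i s IH] mF.
  by under eq_fun do rewrite big_nil.
under eq_fun do rewrite big_cons; apply: measurable_maxr.
  by apply: mF; rewrite inE eqxx.
by apply: IH => j js; apply: mF; rewrite inE js orbT.
Qed.

Variable w : X -> edge sigma -> R.

Lemma measurable_bottleneck_at n e :
  (forall f, prefix (child e) (child f) -> measurable_fun setT (w ^~ f)) ->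
  measurable_fun setT (fun t => bottleneck_at (w t) n e).
Proof.
elim: n e => [|n IH] e mw /=; first by apply: mw; exact: prefix_refl.
apply: measurable_maxr; first by apply: mw; exact: prefix_refl.
apply: measurable_bigmin => i; apply: IH => f /prefixP[v vf]; apply: mw.
by apply/prefixP; exists (i :: v); rewrite vf /child cat_rcons.
Qed.

Hypothesis w01 : forall t e, 0 <= w t e <= 1.
Variable i0 : 'I_sigma.

Lemma measurable_bottleneck e :
  (forall f, prefix (child e) (child f) -> measurable_fun setT (w ^~ f)) ->
  measurable_fun setT (fun t => bottleneck (w t) e).
Proof.
move=> mw; rewrite [X in measurable_fun _ X](_ : _ = fun t =>
    sups (fun n => bottleneck_at (w t) n e) 0).
  apply: (@measurable_fun_sups _ _ _ _ (fun n t => bottleneck_at (w t) n e)).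
    by move=> t _; exact: (has_ubound_bottleneck_at i0 (w01 t)).
  by move=> n; exact: measurable_bottleneck_at.
by apply/funext => t; congr sup; apply/seteqP; split=> r [n _ <-]; exists n.
Qed.

Lemma measurable_path_threshold x k :
  (forall l, (l < size x)%N -> measurable_fun setT (w ^~ (path_edge i0 x l))) ->
  (forall f, prefix x (child f) -> measurable_fun setT (w ^~ f)) ->
  (0 < size x)%N -> measurable_fun setT (fun t => path_threshold i0 (w t) x k).
Proof.
move=> mp mb x0; apply: measurable_bigmax => [|l].
  apply: measurable_bottleneck => f; rewrite child_path_edge; last by lia.
  by rewrite prednK// take_size; exact: mb.
by rewrite mem_index_iota => /andP[_ lx]; apply: mp; lia.
Qed.

End MeasurableBranches.

(** * Independence and Fubini *)

Section Cylinders.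
Context {T : pointedType} {d : measure_display} {Y : measurableType d} {I : eqType}.
Variable u : I -> T -> Y.

(** A pi-system generating the sigma-algebra of the coordinates in [E]. Independence is expressed
    between such sub-sigma-algebras of the one space [T]. *)
Definition cylinder (E : set I) : set (set T) :=
  [set A | exists (J : seq I) (B : I -> set Y),
    [/\ forall i, i \in J -> E i, forall i, measurable (B i)
      & A = [set t | forall i, i \in J -> B i (u i t)]]].

Lemma cylinder_setI E : setI_closed (cylinder E).
Proof.
move=> _ _ [J1 [B1 [J1E mB1 ->]]] [J2 [B2 [J2E mB2 ->]]].
exists (J1 ++ J2), (fun i => (if i \in J1 then B1 i else setT) `&`
                             (if i \in J2 then B2 i else setT)); split.
- by move=> i; rewrite mem_cat => /orP[/J1E|/J2E].
- by move=> i; apply: measurableI; case: ifP.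
- apply/seteqP; split=> t /=.
    by move=> [h1 h2] i _; split; case: ifP => // iJ; [exact: h1|exact: h2].
  move=> h; split=> i iJ; have := h i; rewrite mem_cat iJ ?orbT => /(_ isT)[] //.
Qed.

Lemma cylinder_setT E : cylinder E setT.
Proof. by exists [::], (fun=> setT); split=> //; apply/seteqP; split. Qed.

Lemma cylinder_sub E E' : E `<=` E' -> cylinder E `<=` cylinder E'.
Proof. by move=> EE' _ [J [B [JE mB ->]]]; exists J, B; split=> // i /JE/EE'. Qed.

Lemma sigma_cylinder_sub E E' : E `<=` E' -> <<s cylinder E >> `<=` <<s cylinder E' >>.
Proof. by move=> EE'; apply: sub_sigma_algebra2; exact: cylinder_sub. Qed.

Lemma measurable_fun_cylinder E i : E i ->
  measurable_fun setT (u i : g_sigma_algebraType (cylinder E) -> Y).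
Proof.
move=> Ei _ B mB; rewrite setTI; apply: sub_sigma_algebra.
exists [:: i], (fun=> B); split=> //; first by move=> j; rewrite inE => /eqP->.
apply/seteqP; split=> t /=; first by move=> Bt j; rewrite inE => /eqP->.
by apply; rewrite inE.
Qed.

End Cylinders.

Section Independence.
Context {d : measure_display} {T : measurableType d} {R : realType} (P : probability T R).
Context {dY : measure_display} {Y : measurableType dY} {I : eqType}.
Variable u : I -> T -> Y.
Hypothesis mu : forall i, measurable_fun setT (u i).

Lemma cylinder_measurable E : cylinder u E `<=` measurable.
Proof.
move=> _ [J [B [_ mB ->]]]; elim: J => [|i J IH].
  by rewrite [X in measurable X](_ : _ = setT)//; apply/seteqP; split.
rewrite [X in measurable X](_ : _ = u i @^-1` B i `&`
    [set t | forall j, j \in J -> B j (u j t)]).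
  by apply: measurableI => //; rewrite -[X in measurable X]setTI; exact: mu.
apply/seteqP; split=> t /=.
  by move=> h; split=> [|j jJ]; apply: h; rewrite inE ?eqxx// jJ orbT.
by move=> [hi h] j; rewrite inE => /orP[/eqP ->|/h].
Qed.

Lemma sigma_cylinder_measurable E : <<s cylinder u E >> `<=` measurable.
Proof. exact: smallest_sub (@sigma_algebra_measurable _ T) (@cylinder_measurable E). Qed.

Hypothesis iu : mutually_independent P u.

Lemma cylinder_indep E E' A A' : [disjoint E & E'] -> cylinder u E A -> cylinder u E' A' ->
  P (A `&` A') = (P A * P A')%E.
Proof.
move=> /disj_setPS EE' [J [B [JE mB ->]]] [J' [B' [JE' mB' ->]]].
have JJ' i : i \in J' -> i \in J -> False by move=> /JE' E'i /JE Ei; exact: (EE' i).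
have mem_undupE (K : seq I) (C : I -> set Y) : [set t | forall i, i \in K -> C i (u i t)] =
    [set t | forall i, i \in undup K -> C i (u i t)].
  by apply/seteqP; split=> t h i; [rewrite mem_undup|rewrite -mem_undup] => /h.
pose B2 i := if i \in J then B i else B' i.
have -> : [set t | forall i, i \in J -> B i (u i t)] `&`
          [set t | forall i, i \in J' -> B' i (u i t)] =
    [set t | forall i, i \in undup J ++ undup J' -> B2 i (u i t)].
  apply/seteqP; split=> t /=.
    move=> [h h'] i; rewrite mem_cat !mem_undup /B2; case: ifP => [iJ _|_ /=]; first exact: h.
    exact: h'.
  move=> h; split=> i iJ; have := h i; rewrite mem_cat !mem_undup iJ ?orbT => /(_ isT).
    by rewrite /B2 iJ.
  by rewrite /B2; case: ifP => // iJ2; case: (JJ' i).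
rewrite iu; last 2 first.
- rewrite cat_uniq !undup_uniq andbT/=; apply/hasPn => i; rewrite !mem_undup => iJ'.
  by apply/negP => iJ; exact: (JJ' i).
- by move=> i; rewrite /B2; case: ifP.
rewrite big_cat/= (mem_undupE J) (mem_undupE J') !iu ?undup_uniq//; congr (_ * _)%E.
  by apply: eq_big_seq => i; rewrite mem_undup /B2 => ->.
apply: eq_big_seq => i; rewrite mem_undup /B2; case: ifP => // iJ iJ'; by case: (JJ' i).
Qed.

Lemma sigma_cylinder_indep E E' A A' : [disjoint E & E'] ->
  <<s cylinder u E >> A -> <<s cylinder u E' >> A' -> P (A `&` A') = (P A * P A')%E.
Proof.
move=> EE' sA sA'.
(* Intersecting with [B] and multiplying by [P B] give two finite measures that agree on the
   pi-system [G], hence on the sigma-algebra it generates. This is applied once for each of the two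
   events. *)
have step F (G : set (set T)) B : G `<=` measurable -> setI_closed G -> G setT ->
    measurable B -> (forall A, G A -> P (A `&` B) = (P A * P B)%E) ->
    <<s G >> F -> P (F `&` B) = (P F * P B)%E.
  move=> Gm GI GT mB GB sF.
  have PB : P B \is a fin_num by exact: fin_num_measure.
  pose r : {nonneg R} := NngNum (fine_ge0 (measure_ge0 P B)).
  have -> : (P F * P B)%E = mscale r P F by rewrite /mscale /= fineK// muleC.
  apply: (@g_sigma_algebra_measure_unique _ _ _ G Gm (fun=> setT) _ _ (mrestr P mB) (mscale r P)) => //.
  - by rewrite bigcup_const.
  - by move=> A0 GA0; rewrite /= /mrestr GB//= /mscale/= fineK// muleC.
  - by move=> _; rewrite /= /mrestr setTI -ge0_fin_numE.
have mA' := sigma_cylinder_measurable sA'.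
apply: (step _ _ _ (@cylinder_measurable E) (@cylinder_setI _ _ _ _ u E)
  (@cylinder_setT _ _ _ _ u E) mA' _ sA) => A0 cA0.
rewrite setIC muleC; apply: (step _ _ _ (@cylinder_measurable E') (@cylinder_setI _ _ _ _ u E')
  (@cylinder_setT _ _ _ _ u E') (cylinder_measurable cA0) _ sA') => A1 cA1.
by rewrite setIC muleC; exact: cylinder_indep cA0 cA1.
Qed.

(** Measurability of the intersection is carried along because the induction splits off one event
    and needs the intersection of the others in the sigma-algebra of their union. *)
Lemma sigma_cylinder_indep_seq (J : eqType) (L : seq J) (E : J -> set I) (A : J -> set T) :
  uniq L -> (forall j k, j \in L -> k \in L -> j != k -> [disjoint E j & E k]) ->
  (forall j, j \in L -> <<s cylinder u (E j) >> (A j)) ->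
  <<s cylinder u (\bigcup_(j in [set` L]) E j) >> [set t | forall j, j \in L -> A j t] /\
  P [set t | forall j, j \in L -> A j t] = (\prod_(j <- L) P (A j))%E.
Proof.
elim: L => [_ _ _|j L IH /= /andP[jL uL] dL mL].
  have -> : [set t | forall j, j \in [::] -> A j t] = setT by apply/seteqP; split.
  rewrite big_nil probability_setT; split=> //.
  by apply: sub_sigma_algebra; exact: cylinder_setT.
have [||mI IP] := IH uL; first by
  move=> a b aL bL ab; apply: dL => //; rewrite inE ?aL ?bL orbT.
- by move=> a aL; apply: mL; rewrite inE aL orbT.
have -> : [set t | forall k, k \in j :: L -> A k t] =
    A j `&` [set t | forall k, k \in L -> A k t].
  apply/seteqP; split=> t /=.
    by move=> h; split=> [|k kL]; apply: h; rewrite inE ?eqxx// kL orbT.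
  by move=> [Aj h] k; rewrite inE => /orP[/eqP->|/h].
have mAj : <<s cylinder u (E j) >> (A j) by apply: mL; rewrite inE eqxx.
rewrite big_cons -IP; split; last first.
  apply: sigma_cylinder_indep mAj mI.
  apply/disj_setPS => i [Eji [k /= kL Eki]].
  have jk : j != k by apply: contraNneq jL => ->.
  have kL' : k \in j :: L by rewrite inE kL orbT.
  by have /disj_setPS/(_ i) := dL j k (mem_head _ _) kL' jk; apply.
apply: (@measurableI _ (g_sigma_algebraType (cylinder u (\bigcup_(j0 in [set` j :: L]) E j0)))).
  apply: sigma_cylinder_sub mAj => i Eji; exists j => //=; by rewrite inE eqxx.
apply: sigma_cylinder_sub mI => i [k /= kL Eki]; exists k => //=; by rewrite inE kL orbT.
Qed.

Section Fubini.
Variables E E' : set I.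
Hypothesis EE' : [disjoint E & E'].
Let T1 := g_sigma_algebraType (cylinder u E).
Let T2 := g_sigma_algebraType (cylinder u E').

Let id1 : T -> T1 := id.
Let id2 : T -> T2 := id.
Let id12 : T -> T1 * T2 := fun t => (t, t).

Let mid1 : measurable_fun setT id1.
Proof. by move=> _ B mB; rewrite setTI; exact: sigma_cylinder_measurable mB. Qed.

Let mid2 : measurable_fun setT id2.
Proof. by move=> _ B mB; rewrite setTI; exact: sigma_cylinder_measurable mB. Qed.

Let mid12 : measurable_fun setT id12.
Proof. exact: measurable_fun_pair mid1 mid2. Qed.

Let X1 : {mfun T >-> T1} := mfun_Sub (mem_set mid1).
Let X2 : {mfun T >-> T2} := mfun_Sub (mem_set mid2).
Let X12 : {mfun T >-> (T1 * T2)%type} := mfun_Sub (mem_set mid12).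

(** Independence says that the diagonal map sends [P] to the product of its restrictions to the two
    sub-sigma-algebras. On the right [s] supplies the weights in [E] and [t] those in [E']; this
    replaces a splitting of [T] into factors. *)
Lemma indep_fubini (f : T1 * T2 -> \bar R) : measurable_fun setT f ->
  (forall z, (0 <= f z)%E) ->
  (\int[P]_t f (t, t) = \int[P]_s \int[P]_t f (s, t))%E.
Proof.
move=> mf f0.
have -> : (\int[P]_t f (t, t) = \int[distribution P X12]_z f z)%E.
  by rewrite ge0_integral_distribution.
rewrite (@eq_measure_integral _ _ _ setT (distribution P X1 \x distribution P X2)%E); last first.
  move=> B mB _; apply/esym/product_measure_unique => // B1 B2 mB1 mB2.
  exact: sigma_cylinder_indep EE' mB1 mB2.
rewrite fubini_tonelli1// ge0_integral_distribution; last 2 first.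
- exact: measurable_fun_fubini_tonelli_F.
- by move=> s; exact: integral_ge0.
apply: eq_integral => s _ /=; rewrite /fubini_F ge0_integral_distribution//.
exact: measurableT_comp.
Qed.

Lemma indep_fubini_set (B : set (T1 * T2)) (g : T1 -> R) : measurable B ->
  measurable_fun setT g -> (forall s, 0 <= g s) ->
  (\int[P]_(t in [set t | B (t, t)]) (g t)%:E =
   \int[P]_s ((g s)%:E * P [set t | B (s, t)]))%E.
Proof.
move=> mB mg g0.
have mD : measurable [set t : T | B (t, t)] by rewrite -[X in measurable X]setTI; exact: mid12.
rewrite integral_mkcond.
pose f (z : T1 * T2) := ((g z.1)%:E * (\1_B z)%:E)%E.
transitivity (\int[P]_t f (t, t))%E.
  apply: eq_integral => t _ /=; rewrite patchE /f indicE.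
  case: (boolP (t \in _)) => h; first by rewrite (mem_set (set_mem h : B (t, t))) mule1.
  rewrite (_ : (t, t) \in B = false) ?mule0//; apply/negbTE; apply: contra h.
  by rewrite !inE.
rewrite (@indep_fubini f); last 2 first.
- apply: emeasurable_funM; apply/measurable_EFinP; last exact: measurable_indic.
  exact: measurableT_comp.
- by move=> z; rewrite mule_ge0 ?lee_fin.
apply: eq_integral => s _.
have mBs : measurable [set t : T | B (s, t)].
  apply: (@sigma_cylinder_measurable E').
  have := @measurable_xsection _ _ T1 T2 B s mB.
  by rewrite /xsection; under eq_set do rewrite inE.
rewrite /f/= ge0_integralZl//; last 2 first.
- apply/measurable_EFinP.
  rewrite (_ : (fun x => _) = \1_[set t : T | B (s, t)]); last first.
    by apply/funext => t; rewrite !indicE; congr (_%:R); apply/idP/idP; rewrite !inE.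
  exact: measurable_indic.
- by rewrite lee_fin.
congr (_ * _)%E; rewrite -(setIT [set t | B (s, t)]) -integral_indic//.
Qed.

Lemma indep_fubini_prob (B : set (T1 * T2)) : measurable B ->
  P [set t | B (t, t)] = (\int[P]_s P [set t | B (s, t)])%E.
Proof.
move=> mB; have := @indep_fubini_set B (cst 1) mB (measurable_cst _) (fun=> ler01).
under [in RHS]eq_integral do rewrite mul1e; move <-.
have mD : measurable [set t : T | B (t, t)] by rewrite -[X in measurable X]setTI; exact: mid12.
by have := integral_cst P mD 1; rewrite mul1e.
Qed.

End Fubini.
End Independence.

(** * The survival probability *)

Section Below.
Variables (sigma : nat) (i0 : 'I_sigma).
Implicit Types (e f g : edge sigma) (x y z : vertex sigma).

Definition below e : set (edge sigma) := [set f | prefix (child e) (child f)].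

Lemma prefix_comparable x y z : prefix x z -> prefix y z -> (size x <= size y)%N -> prefix x y.
Proof.
rewrite !prefixE => /eqP xz /eqP yz xy; apply/eqP.
by rewrite -{1}yz take_takel.
Qed.

Lemma child_inj e f : child e = child f -> e = f.
Proof. by case: e f => [x i] [y j] /rcons_inj[-> ->]. Qed.

Lemma below_disjoint e f : ~ prefix (child e) (child f) -> ~ prefix (child f) (child e) ->
  [disjoint below e & below f].
Proof.
move=> ef fe; apply/disj_setPS => g [/= eg fg].
have [le|lt] := leqP (size (child e)) (size (child f)).
  exact/ef/(prefix_comparable eg fg).
exact/fe/(prefix_comparable fg eg)/ltnW.
Qed.

Lemma below_sibling_disjoint x i j : i <> j -> [disjoint below (x, i) & below (x, j)].
Proof.
move=> ij; apply: below_disjoint => /prefix_eqw; rewrite /child/= !size_rcons;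
  by move=> /(_ (leqnn _))/rcons_inj[/esym]// ij'; apply: ij.
Qed.

Lemma off_path_not_prefix x f : off_path x f -> ~ prefix (child f) x.
Proof.
move=> /and3P[_ _ /eqP cf]; rewrite prefixE => /eqP fx; apply: cf.
by rewrite -[LHS]fx size_rcons.
Qed.

(** If one lower endpoint were a proper prefix of the other, it would be a prefix of the other's
    upper endpoint and therefore lie on the path to [x]. *)
Lemma off_path_disjoint x e f : off_path x e -> off_path x f -> e != f ->
  [disjoint below e & below f].
Proof.
suff H e' f' : off_path x e' -> off_path x f' -> e' != f' -> ~ prefix (child e') (child f').
  by move=> oe of_ ef; apply: below_disjoint; apply: H => //; rewrite eq_sym.
move=> oe of_ ef pef; have [lt|ge] := ltnP (size (child e')) (size (child f')); last first.
  by move/eqP: ef; apply; apply/child_inj/prefix_eqw.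
apply: (off_path_not_prefix oe); case/and3P: of_ => _ /eqP f1 _.
have pf : prefix f'.1 (child f') by apply/prefixP; exists [:: f'.2]; rewrite cats1.
have := prefix_comparable pef pf; rewrite !size_rcons in lt *; move=> /(_ lt).
rewrite {1}f1 => /prefixP[u uE]; apply/prefixP.
by exists (u ++ drop (size f'.1) x); rewrite catA -uE cat_take_drop.
Qed.

Lemma off_path_below x f g : off_path x f -> below f g -> ~ prefix x (child g).
Proof.
move=> of_ fg xg; apply: (off_path_not_prefix of_).
by apply: prefix_comparable fg xg _; rewrite size_rcons; case/and3P: of_.
Qed.

Lemma off_path_path_edge x f l : off_path x f -> (l < size x)%N -> ~ below f (path_edge i0 x l).
Proof.
move=> of_ lx; rewrite /below/= child_path_edge// => /prefixP[u uE].
apply: (off_path_not_prefix of_); apply/prefixP; exists (u ++ drop l.+1 x).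
by rewrite catA -uE cat_take_drop.
Qed.

Definition off_edges x : seq (edge sigma) :=
  [seq f <- [seq (take k x, i) | k <- iota 0 (size x), i <- enum 'I_sigma] | off_path x f].

Lemma off_edges_uniq x : uniq (off_edges x).
Proof.
apply/filter_uniq/allpairs_uniq; [exact: iota_uniq|exact: enum_uniq|].
move=> [k i] [l j] /allpairsP[[a b] [/= + _ [-> ->]]] /allpairsP[[c d] [/= + _ [-> ->]]].
rewrite !mem_iota !add0n /= => ka kc [/(congr1 size) + ->].
by rewrite !size_takel ?(ltnW ka) ?(ltnW kc)// => ->.
Qed.

Lemma mem_off_edges x f : (f \in off_edges x) = off_path x f.
Proof.
rewrite mem_filter; case: (boolP (off_path x f)) => //= /and3P[fx /eqP f1 _].
apply/allpairsP; exists (size f.1, f.2); split=> /=.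
- by rewrite mem_iota add0n.
- by rewrite mem_enum.
- by rewrite -f1; case: f {fx f1}.
Qed.

End Below.

Section SurvivalProbability.
Variables (R : realType) (sigma : nat).
Hypothesis sigma_ge2 : (2 <= sigma)%N.

(* The probability that percolation with parameter p reaches depth n.+1 through
   a given edge. *)
Fixpoint reach (n : nat) (p : R) : R :=
  if n is n'.+1 then p * (1 - (1 - reach n' p) ^+ sigma) else p.

(** This is (1 - (1 - s)^sigma) / s written as a polynomial, which includes s = 0, where its value
    is sigma. *)
Definition geometric_sum (s : R) : R := \sum_(j < sigma) (1 - s) ^+ j.

Lemma geometric_sum_ge1 s : s <= 1 -> 1 <= geometric_sum s.
Proof.
rewrite /geometric_sum; case: sigma sigma_ge2 => // n _ s1; rewrite big_ord_recl expr0 lerDl.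
by apply: sumr_ge0 => i _; apply: exprn_ge0; rewrite subr_ge0.
Qed.

Lemma geometric_sumM s : s * geometric_sum s = 1 - (1 - s) ^+ sigma.
Proof.
have := subrX1 (1 - s) sigma; rewrite -/(geometric_sum s) => h.
by rewrite -[RHS]opprB h; ring.
Qed.

(** Strictness comes from the term of index 1, which is present because sigma is at least 2. *)
Lemma geometric_sum_lt s t : s < t -> t <= 1 -> geometric_sum t < geometric_sum s.
Proof.
rewrite /geometric_sum; case: sigma sigma_ge2 => [//|[//|n]] _ st t1; rewrite !big_ord_recl !expr0 ltrD2l.
rewrite /= !expr1; apply: ltr_leD; first by lra.
by apply: ler_sum => i _; rewrite lerXn2r ?nnegrE; lra.
Qed.

(* The parameter at which the survival probability through an edge equals s. *)
Definition survival_inv (s : R) : R := (geometric_sum s)^-1.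

Lemma survival_inv01 s : s <= 1 -> 0 <= survival_inv s <= 1.
Proof.
move=> s1; have h := geometric_sum_ge1 s1.
by rewrite invr_ge0 (le_trans ler01 h) invf_le1// (lt_le_trans ltr01 h).
Qed.

Lemma survival_inv1 : survival_inv 1 = 1.
Proof.
rewrite /survival_inv /geometric_sum subrr; case: sigma sigma_ge2 => // n _.
rewrite big_ord_recl expr0 big1 ?addr0 ?invr1// => i _.
by rewrite /= expr0n.
Qed.

Lemma reach_mono (p a b : R) : 0 <= p -> a <= b -> b <= 1 ->
  p * (1 - (1 - a) ^+ sigma) <= p * (1 - (1 - b) ^+ sigma).
Proof.
move=> p0 ab b1; apply: ler_wpM2l => //; rewrite lerD2l lerN2.
by rewrite lerXn2r ?nnegrE; lra.
Qed.

Lemma reach01 n p : 0 <= p <= 1 -> 0 <= reach n p <= 1.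
Proof.
move=> p01; have /andP[p0 p1] := p01; elim: n => [//|n /andP[r0 r1]] /=.
have h0 : 0 <= (1 - reach n p) ^+ sigma by apply: exprn_ge0; lra.
have h1 : (1 - reach n p) ^+ sigma <= 1 by apply: exprn_ile1; lra.
by apply/andP; split; nra.
Qed.

Lemma survival_inv_fixpoint s : s <= 1 ->
  survival_inv s * (1 - (1 - s) ^+ sigma) = s.
Proof.
move=> s1; rewrite -geometric_sumM mulrCA mulVf ?mulr1//.
by rewrite gt_eqF// (lt_le_trans ltr01)// geometric_sum_ge1.
Qed.

(** [s] is a fixed point of the monotone iteration, and the starting value [survival_inv s]
    dominates it. This keeps the limit away from the trivial root 0 when [s] is positive. *)
Lemma reach_ge n s : 0 <= s <= 1 -> s <= reach n (survival_inv s).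
Proof.
move=> /andP[s0 s1]; have p01 := survival_inv01 s1; have /andP[p0 p1] := p01.
elim: n => [|n IH] /=.
  rewrite -{1}(survival_inv_fixpoint s1) ler_piMr// gerBl exprn_ge0//; lra.
rewrite -{1}(survival_inv_fixpoint s1); apply: reach_mono => //.
by have /andP[] := reach01 n p01.
Qed.

(** The limit is a fixed point not below [s]. If it is nonzero, dividing the equation by it gives
    [p * geometric_sum L = 1], and strict monotonicity yields [L = s]; if it is 0, so is [s]. *)
Lemma reach_cvg_survival_inv s (L : R) : 0 <= s <= 1 ->
  reach n (survival_inv s) @[n --> \oo] --> L -> L = s.
Proof.
move=> s01 cvL; have /andP[s0 s1] := s01; set p := survival_inv s in cvL *.
have /andP[p0 p1] := survival_inv01 s1.
have sL : s <= L.
  rewrite -(cvg_lim (@Rhausdorff R) cvL).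
  by apply: limr_ge; [apply/cvg_ex; exists L|near=> n; exact: reach_ge].
have L1 : L <= 1.
  rewrite -(cvg_lim (@Rhausdorff R) cvL).
  apply: limr_le; [by apply/cvg_ex; exists L|near=> n].
  by have /andP[] := reach01 n (survival_inv01 s1).
have LE : L = p * (1 - (1 - L) ^+ sigma).
  have c1 : reach n.+1 p @[n --> \oo] --> L by rewrite (cvg_shiftS (reach ^~ p)).
  apply: (cvg_unique (@Rhausdorff R) c1) => /=.
  apply: cvgM; first exact: cvg_cst.
  apply: cvgB; first exact: cvg_cst.
  apply: (@continuous_cvg _ _ _ _ _ _ (fun x : R => x ^+ sigma)).
    exact: exprn_continuous.
  by apply: cvgB => //; exact: cvg_cst.
have [L0|L0] := eqVneq L 0; first by apply/eqP; rewrite eq_le sL L0 andbT.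
have [//|/eqP Ls] := pselect (L = s).
have := geometric_sum_lt (_ : s < L) L1; rewrite lt_neqAle eq_sym Ls sL => /(_ isT).
suff -> : geometric_sum L = geometric_sum s by rewrite ltxx.
have G0 : geometric_sum s != 0.
  by rewrite gt_eqF// (lt_le_trans ltr01)// geometric_sum_ge1.
move: LE; rewrite -geometric_sumM mulrCA => LE.
have : p * geometric_sum L = 1 by apply: (mulfI L0); rewrite mulr1 -LE.
by move=> h; rewrite -[RHS]mulr1 -h mulrA divff// mul1r.
Unshelve. all: by end_near. Qed.

End SurvivalProbability.

Lemma ae_all (d : measure_display) (T : measurableType d) (R : realType)
  (m : {measure set T -> \bar R}) (I : countType) (Q : I -> T -> Prop) :
  (forall i, {ae m, forall t, Q i t}) -> {ae m, forall t, forall i, Q i t}.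
Proof.
move=> aeQ; have : {ae m, forall t, forall n : nat,
    if @unpickle I n is Some i then Q i t else True}.
  apply: ae_foralln => n; case: (unpickle n) => [i|]; first exact: aeQ.
  exact: aeW.
by apply: filterS => t h i; have := h (pickle i); rewrite pickleK.
Qed.

Lemma measure_real_unique (R : realType) (m1 m2 : {measure set R -> \bar R}) :
  (m1 setT < +oo)%E -> (forall p, m1 `]p, +oo[%classic = m2 `]p, +oo[%classic) ->
  forall A : set R, measurable A -> m1 A = m2 A.
Proof.
move=> m1oo m12 A mA.
apply: (@measure_unique _ _ _ (@RGenOInfty.G R) (fun n => `]- n%:R, +oo[%classic)
  (RGenOInfty.measurableE R) _ _ _ m1 m2) => //.
- move=> _ _ [x ->] [y ->]; exists (Num.max x y); apply/seteqP; split=> z /=;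
    by rewrite !in_itv/= !andbT gt_max => /andP.
- by move=> n; eexists.
- apply/seteqP; split=> // x _; exists (Num.truncn `|x|).+1 => //=.
  by rewrite in_itv/= andbT ltrNl (le_lt_trans _ (truncnS_gt _))// ler_normr lexx orbT.
- by move=> _ [p ->].
- by move=> n; apply: le_lt_trans m1oo; apply: le_measure; rewrite ?inE.
Qed.

Section UniformWeights.
Context {R : realType} (sigma : nat) (i0 : 'I_sigma).
Hypothesis sigma_ge2 : (2 <= sigma)%N.
Context {d : measure_display} {T : measurableType d} (P : probability T R).
Variable w : T -> edge sigma -> R.
Hypothesis mw : forall e, measurable_fun setT (w ^~ e).
Hypothesis w01 : forall t e, 0 <= w t e <= 1.
Hypothesis iw : mutually_independent P (fun e t => w t e).
Hypothesis wP : forall e p, 0 <= p <= 1 -> P [set t | w t e <= p] = p%:E.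
Implicit Types (e f : edge sigma) (x : vertex sigma) (p : R).

Notation cyl E := (cylinder (fun e t => w t e) E).
Notation sub_space E := (g_sigma_algebraType (cyl E)).

Lemma measurable_weight_cyl E e : E e ->
  measurable_fun setT ((fun t => w t e) : sub_space E -> R).
Proof. exact: (@measurable_fun_cylinder T _ _ _ (fun e t => w t e)). Qed.

Lemma measurable_bottleneck_cyl E e : below e `<=` E ->
  measurable_fun setT ((fun t => bottleneck (w t) e) : sub_space E -> R).
Proof.
by move=> eE; apply: (@measurable_bottleneck _ (sub_space E) R sigma w w01 i0) => f ef; apply: measurable_weight_cyl; exact: eE.
Qed.

Lemma measurable_bottleneck_weights e : measurable_fun setT (fun t => bottleneck (w t) e).
Proof. exact: measurable_bottleneck. Qed.

Lemma prod_const_prob (J : finType) (A : pred J) (r : R) :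
  (\prod_(j <- enum A) r%:E = (r ^+ #|A|)%:E)%E.
Proof.
by rewrite cardE; elim: (enum A) => [|j s IH]; rewrite ?big_nil// big_cons IH -EFinM -exprS.
Qed.

Lemma siblings_indep x (J : seq 'I_sigma) (A : 'I_sigma -> set T) : uniq J ->
  (forall i, <<s cyl (below (x, i)) >> (A i)) ->
  <<s cyl (\bigcup_i below (x, i)) >> [set t | forall i, i \in J -> A i t] /\
  P [set t | forall i, i \in J -> A i t] = (\prod_(i <- J) P (A i))%E.
Proof.
move=> uJ mA.
have [||mI PI] := @sigma_cylinder_indep_seq _ _ _ P _ _ _ _ mw iw _ J (fun i => below (x, i)) A uJ.
- by move=> i j _ _ /eqP; exact: below_sibling_disjoint.
- by move=> i _; exact: mA.
split=> //; apply: sigma_cylinder_sub mI => f [i _ fi]; by exists i.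
Qed.

(** One gets one level deeper iff [e] is open and not all of the sigma independent subtrees below it
    fail; this is the recursion of [reach]. *)
Lemma bottleneck_at_prob n e p : 0 <= p <= 1 ->
  P [set t | bottleneck_at (w t) n e <= p] = (reach sigma n p)%:E.
Proof.
move=> p01; elim: n e => [|n IH] e; first exact: wP.
pose A i := [set t | p < bottleneck_at (w t) n (child e, i)].
have mA i : <<s cyl (below (child e, i)) >> (A i).
  apply: (@measurable_lt _ (sub_space (below (child e, i)))); first exact: measurable_cst.
  by apply: measurable_bottleneck_at => f; exact: measurable_weight_cyl.
have PA i : P (A i) = (1 - reach sigma n p)%:E.
  rewrite EFinB -(IH (child e, i)) -probability_setC.
    by congr (P _); apply/seteqP; split=> t; rewrite /A/= ltNge => /negP.
  apply: measurable_le; last exact: measurable_cst.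
  by apply: measurable_bottleneck_at.
have [mI PI] := siblings_indep (enum_uniq 'I_sigma) mA.
rewrite (eq_bigr _ (fun i _ => PA i)) prod_const_prob card_ord in PI.
rewrite (_ : [set t | _ ] = [set t | w t e <= p] `&`
    ~` [set t | forall i, i \in enum 'I_sigma -> A i t]); last first.
  apply/seteqP; split=> t /=.
    move=> /(bottleneck_atS_le i0 (w01 t))[we [i hi]]; split=> //.
    by move=> /(_ i (mem_enum _ _)); rewrite /A/= ltNge hi.
  move=> [we /existsNP[i /not_implyP[_ /negP]]]; rewrite -leNgt => hi.
  by apply/(bottleneck_atS_le i0 (w01 t)); split=> //; exists i.
rewrite (@sigma_cylinder_indep _ _ _ P _ _ _ _ mw iw [set e] (\bigcup_i below (child e, i))).
- rewrite wP// probability_setC ?PI; last exact: (sigma_cylinder_measurable mw mI).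
  by rewrite -EFinB -EFinM.
- apply/disj_setPS => _ [/= -> [i _]] /size_prefixw.
  by rewrite !size_rcons ltnn.
- apply: (@measurable_le _ (sub_space [set e])); last exact: measurable_cst.
  exact: measurable_weight_cyl.
- exact: (@measurableC _ (sub_space (\bigcup_i below (child e, i)))).
Qed.

Lemma reach_cvg_bottleneck e p : 0 <= p <= 1 ->
  reach sigma n p @[n --> \oo] --> fine (P [set t | bottleneck (w t) e <= p]).
Proof.
move=> p01; have mF n : measurable [set t | bottleneck_at (w t) n e <= p].
  by apply: measurable_le; [exact: measurable_bottleneck_at|exact: measurable_cst].
have FE : [set t | bottleneck (w t) e <= p] = \bigcap_n [set t | bottleneck_at (w t) n e <= p].
  apply/seteqP; split=> t /= h.
    by move=> n _ /=; exact: le_trans (bottleneck_at_le i0 (w01 t) n e) h.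
  by apply: (bottleneck_le) => n; exact: h.
have cvF := @nonincreasing_cvg_mu _ _ _ P (fun n => [set t | bottleneck_at (w t) n e <= p]).
have {cvF} : (reach sigma n p)%:E @[n --> \oo] --> P [set t | bottleneck (w t) e <= p].
  rewrite FE -[X in X @ _](_ : P \o (fun n => [set t | bottleneck_at (w t) n e <= p]) = _).
    apply: cvF => //.
    - by rewrite (le_lt_trans (probability_le1 _ _))// ltry.
    - exact: bigcapT_measurable.
    apply/nonincreasing_seqP => n; apply/subsetPset => t.
    move=> /(proj1 (bottleneck_at_leP i0 (w01 t) n.+1 e p))[u su ou].
    apply: (proj2 (bottleneck_at_leP i0 (w01 t) n e p)); exists (take n u); first by rewrite size_takel// su.
    by apply: (@open_below_cat _ _ _ _ (drop n u)); rewrite cat_take_drop.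
  by apply/funext => n /=; rewrite bottleneck_at_prob.
move=> h; suff /fine_cvgP[_] : (reach sigma n p)%:E @[n --> \oo] -->
  (fine (P [set t | bottleneck (w t) e <= p]))%:E by [].
by rewrite fineK// fin_num_measure// FE; exact: bigcapT_measurable.
Qed.

Lemma bottleneck_survival_inv e s : 0 <= s <= 1 ->
  P [set t | bottleneck (w t) e <= survival_inv sigma s] = s%:E.
Proof.
move=> s01; have p01 := survival_inv01 sigma_ge2 (proj2 (andP s01)).
have E := reach_cvg_survival_inv sigma_ge2 s01 (@reach_cvg_bottleneck e _ p01).
rewrite -[LHS]fineK ?E// fin_num_measure//; apply: measurable_le; last exact: measurable_cst.
exact: measurable_bottleneck_weights.
Qed.

Lemma bottleneck_no_atom e c : P [set t | bottleneck (w t) e = c] = 0%E.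
Proof.
have mb := measurable_bottleneck_weights e.
have mle p : measurable [set t | bottleneck (w t) e <= p].
  by apply: measurable_le => //; exact: measurable_cst.
have meq : measurable [set t | bottleneck (w t) e = c].
  by apply: measurable_eq => //; exact: measurable_cst.
suff H n : (P [set t | bottleneck (w t) e = c] <= (n.+1%:R^-1)%:E)%E.
  apply/eqP; rewrite eq_le measure_ge0 andbT; apply/lee_addgt0Pr => eps eps0.
  rewrite add0e; apply: le_trans (H (Num.truncn eps^-1)) _.
  by rewrite lee_fin invf_ple ?posrE// ltW// truncnS_gt.
(* The levels [p j] cut the distribution function into steps of height 1 / (n + 1); a single value
   [c] lies within one step and has at most that mass. *)
pose s j : R := j%:R / n.+1%:R.
have s01 j : (j <= n.+1)%N -> 0 <= s j <= 1.
  move=> jn; rewrite /s divr_ge0//= ler_pdivrMr ?ltr0n// mul1r.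
  by rewrite ler_nat.
pose p j := survival_inv sigma (s j).
have Pp j : (j <= n.+1)%N -> P [set t | bottleneck (w t) e <= p j] = (s j)%:E.
  by move=> jn; exact/bottleneck_survival_inv/s01.
have p1 : p n.+1 = 1 by rewrite /p /s divff// survival_inv1.
have [cp|cp] := leP c (p n.+1); last first.
  rewrite [X in P X](_ : _ = set0) ?measure0 ?lee_fin//.
  apply/seteqP; split=> // t /= bc; have /andP[_] := bottleneck01 i0 (w01 t) e.
  by rewrite bc leNgt -p1 cp.
have ex : exists j, c <= p j by exists n.+1.
(* Minimality of the index places [c] between consecutive levels. For index 0 the event is contained
   in one of probability [s 0 = 0]. *)
case: (ex_minnP ex) => -[|j] cj jmin.
  apply: (@le_trans _ _ (P [set t | bottleneck (w t) e <= p 0%N])).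
    by apply: le_measure; rewrite ?inE// => t /= ->.
  by rewrite Pp// /s mul0r lee_fin.
have jn : (j.+1 <= n.+1)%N := jmin _ cp.
have pj : p j < c by rewrite ltNge; apply/negP => /jmin; rewrite ltnn.
have psub : [set t | bottleneck (w t) e <= p j] `<=` [set t | bottleneck (w t) e <= p j.+1].
  by move=> t /= h; rewrite (le_trans h)// (le_trans (ltW pj)).
apply: (@le_trans _ _ (P ([set t | bottleneck (w t) e <= p j.+1] `\`
    [set t | bottleneck (w t) e <= p j]))).
  apply: le_measure; rewrite ?inE//; first exact: measurableD.
  by move=> t /= ->; split=> //; apply/negP; rewrite -ltNge.
rewrite measureD//; last by rewrite (le_lt_trans (probability_le1 _ _))// ltry.
rewrite setIidr// [X in (X - _)%E](Pp _ jn) [X in (_ - X)%E](Pp _ (ltnW jn)) -EFinB lee_fin /s -mulrBl -natrB//.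
by rewrite subSnn mul1r.
Qed.

(** For [p] in [0, 1] both distribution functions are limits of the same sequence [reach], which
    does not see the edge. *)
Lemma bottleneck_same_law e e' p :
  P [set t | p < bottleneck (w t) e] = P [set t | p < bottleneck (w t) e'].
Proof.
have mle e1 : measurable [set t | bottleneck (w t) e1 <= p].
  by apply: measurable_le; [exact: measurable_bottleneck_weights|exact: measurable_cst].
have lt_le e1 : P [set t | p < bottleneck (w t) e1] = (1 - P [set t | (bottleneck (w t) e1 <= p)%R])%E.
  rewrite -probability_setC//; congr (P _).
  by apply/seteqP; split=> t /=; rewrite ltNge => /negP.
rewrite !lt_le; congr (_ - _)%E.
have [p0|p0] := ltP p 0.
  have E0 e1 : [set t | bottleneck (w t) e1 <= p] = set0.
    apply/seteqP; split=> // t /= h; have /andP[] := bottleneck01 i0 (w01 t) e1.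
    by rewrite leNgt (le_lt_trans h).
  by rewrite !E0.
have [p1|p1] := leP p 1; last first.
  have ET e1 : [set t | bottleneck (w t) e1 <= p] = setT.
    apply/seteqP; split=> // t _ /=; have /andP[_ h] := bottleneck01 i0 (w01 t) e1.
    exact: le_trans h (ltW p1).
  by rewrite !ET.
have p01 : 0 <= p <= 1 by rewrite p0.
rewrite -[LHS]fineK ?fin_num_measure// -[RHS]fineK ?fin_num_measure//; congr (_%:E).
exact: cvg_unique (@reach_cvg_bottleneck e _ p01) (@reach_cvg_bottleneck e' _ p01).
Qed.

Lemma integral_bottleneck e e' (g : R -> \bar R) : measurable_fun setT g ->
  (forall r, (0 <= g r)%E) ->
  (\int[P]_t g (bottleneck (w t) e) = \int[P]_t g (bottleneck (w t) e'))%E.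
Proof.
move=> mg g0.
pose X e1 : {mfun T >-> R} := mfun_Sub (mem_set (measurable_bottleneck_weights e1)).
have := @ge0_integral_distribution _ _ _ _ _ P (X e) g mg g0; rewrite /comp/= => <-.
have := @ge0_integral_distribution _ _ _ _ _ P (X e') g mg g0; rewrite /comp/= => <-.
apply: eq_measure_integral => A mA _.
apply: measure_real_unique mA => [|p]; first exact:
  le_lt_trans (@probability_le1 _ _ _ (distribution P (X e)) setT measurableT) (ltry 1).
have E e1 : distribution P (X e1) `]p, +oo[%classic = P [set t | p < bottleneck (w t) e1].
  by congr (P _); apply/seteqP; split=> t /=; rewrite in_itv/= andbT.
exact: etrans (E e) (etrans (bottleneck_same_law e e' p) (esym (E e'))).
Qed.

(** In each of the countably many clauses the two quantities depend on disjoint sets of edges: by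
    Fubini one is frozen, and the other is a bottleneck, which has no atom. *)
Lemma generic_ae : {ae P, forall t, generic (w t)}.
Proof.
have ne0 (A : T -> Prop) : measurable [set t | A t] -> P [set t | A t] = 0%E ->
    {ae P, forall t, ~ A t}.
  by move=> mA A0; exists [set t | A t]; split=> // t /= /contrapT.
have H1 : {ae P, forall t, forall x i j, i <> j -> bottleneck (w t) (x, i) <> bottleneck (w t) (x, j)}.
  apply: ae_all => x; apply: ae_all => i; apply: ae_all => j.
  have [ij|ij] := pselect (i <> j); last exact: aeW.
  suff : {ae P, forall t, ~ (bottleneck (w t) (x, i) = bottleneck (w t) (x, j))}.
    by apply: filterS.
  apply: ne0; first by apply: measurable_eq; exact: measurable_bottleneck_weights.
  have dij := below_sibling_disjoint x ij.
  have := @indep_fubini_prob _ _ _ P _ _ _ _ mw iw _ _ dij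
    [set z | bottleneck (w z.1) (x, i) = bottleneck (w z.2) (x, j)].
  move=> ->; last first.
    apply: measurable_eq.
      exact: (measurableT_comp (measurable_bottleneck_cyl (@subset_refl _ _)) measurable_fst).
    exact: (measurableT_comp (measurable_bottleneck_cyl (@subset_refl _ _)) measurable_snd).
  rewrite integral0_eq// => s _ /=; rewrite -[RHS](bottleneck_no_atom (x, j) (bottleneck (w s) (x, i))).
  by congr (P _); apply/seteqP; split=> t /= ->.
have H2 : {ae P, forall t, forall x i j f, i <> j -> prefix (rcons x i) (child f) ->
    w t f <> bottleneck (w t) (x, j)}.
  apply: ae_all => x; apply: ae_all => i; apply: ae_all => j; apply: ae_all => f.
  have [ij|ij] := pselect (i <> j); last exact: aeW.
  have [pf|pf] := pselect (prefix (rcons x i) (child f)); last exact: aeW.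
  suff : {ae P, forall t, ~ (w t f = bottleneck (w t) (x, j))}.
    by apply: filterS.
  apply: ne0; first by apply: measurable_eq => //; exact: measurable_bottleneck_weights.
  have dij : [disjoint [set f] & below (x, j)].
    apply/disj_setPS => _ [/= -> fj].
    by have /disj_setPS/(_ f) := below_sibling_disjoint x ij; apply.
  have := @indep_fubini_prob _ _ _ P _ _ _ _ mw iw _ _ dij
    [set z | w z.1 f = bottleneck (w z.2) (x, j)].
  move=> ->; last first.
    apply: measurable_eq.
      exact: (measurableT_comp (@measurable_weight_cyl [set f] f erefl) measurable_fst).
    exact: (measurableT_comp (measurable_bottleneck_cyl (@subset_refl _ _)) measurable_snd).
  rewrite integral0_eq// => s _ /=; rewrite -[RHS](bottleneck_no_atom (x, j) (w s f)).
  by congr (P _); apply/seteqP; split=> t /= ->.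
by apply: filterS2 H1 H2 => t h1 h2; split.
Qed.

End UniformWeights.

(** * The direction of the backbone *)

Lemma measure_ae_eq (d : measure_display) (T : measurableType d) (R : realType)
  (m : {measure set T -> \bar R}) (A B : set T) : measurable A -> measurable B ->
  {ae m, forall t, A t <-> B t} -> m A = m B.
Proof.
suff H A' B' : measurable A' -> measurable B' -> {ae m, forall t, A' t <-> B' t} ->
    (m A' <= m B')%E.
  move=> mA mB AB; apply/eqP; rewrite eq_le !H//; by apply: filterS AB => t; tauto.
move=> mA mB [N [mN N0 ABN]]; apply: (@le_trans _ _ (m (B' `|` N))).
  apply: le_measure; rewrite ?inE//; first exact: measurableU.
  move=> t At; have [Bt|nBt] := pselect (B' t); [by left|right; apply: ABN => /=].
  by move=> [/(_ At)].
by rewrite (le_trans (measureU2 _ _ _))// [X in (_ + X)%E]N0 adde0.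
Qed.

Section UniformBackbone.
Context {R : realType} (sigma : nat) (i0 : 'I_sigma).
Hypothesis sigma_ge2 : (2 <= sigma)%N.
Context {d : measure_display} {T : measurableType d} (P : probability T R).
Variable w : T -> edge sigma -> R.
Hypothesis mw : forall e, measurable_fun setT (w ^~ e).
Hypothesis w01 : forall t e, 0 <= w t e <= 1.
Hypothesis iw : mutually_independent P (fun e t => w t e).
Hypothesis wP : forall e p, 0 <= p <= 1 -> P [set t | w t e <= p] = p%:E.
Implicit Types (e f : edge sigma) (x : vertex sigma) (p m : R).

Notation cyl E := (cylinder (fun e t => w t e) E).
Notation sub_space E := (g_sigma_algebraType (cyl E)).

(** The threshold for [rcons x i] with the bottleneck of [(x, i)] replaced by a free value [m]; in
    this form it is the same for all children [i]. *)
Definition detour_threshold x m (t : T) k : R :=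
  \big[Num.max/m]_(k <= l < size x) w t (path_edge i0 x l).

Lemma path_threshold_rcons x i t k :
  path_threshold i0 (w t) (rcons x i) k = detour_threshold x (bottleneck (w t) (x, i)) t k.
Proof.
rewrite /path_threshold /detour_threshold size_rcons /=.
have -> : path_edge i0 (rcons x i) (size x) = (x, i).
  by rewrite /path_edge nth_rcons ltnn eqxx -cats1 take_size_cat.
rewrite !big_seq; apply: eq_bigr => l; rewrite mem_index_iota => /andP[_ lx].
by rewrite /path_edge nth_rcons lx -cats1 takel_cat// ltnW.
Qed.

Definition passes x (t : T) : Prop :=
  forall f, off_path x f -> path_threshold i0 (w t) x (size f.1) < bottleneck (w t) f.

Lemma off_path_rcons x i f : off_path (rcons x i) f <->
  off_path x f \/ exists2 j, j <> i & f = (x, j).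
Proof.
split=> [of_|[of_|[j ji ->]]].
- have [fx|fx] := ltnP (size f.1) (size x).
    left; move: of_; rewrite /off_path fx size_rcons -cats1 takel_cat ?(ltnW fx)//.
    by rewrite takel_cat// => /and3P[_ -> ->].
  case/and3P: of_; rewrite size_rcons ltnS => xf /eqP f1 cf.
  have sf : size f.1 = size x by apply/eqP; rewrite eqn_leq xf fx.
  right; case: f sf f1 cf {xf fx} => y j /= ->; rewrite -cats1 take_size_cat// => ->.
  by rewrite take_oversize ?size_cat ?addn1// cats1 => cj; exists j => // ji; rewrite ji eqxx in cj.
- case/and3P: of_ => fx f1 cf; rewrite /off_path size_rcons ltnS (ltnW fx)/=.
  by rewrite -cats1 !takel_cat ?(ltnW fx)// f1.
- rewrite /off_path/= size_rcons ltnSn/= -cats1 take_size_cat// eqxx/=.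
  rewrite take_oversize ?size_cat ?addn1// cats1 /child/=.
  by apply/eqP => /rcons_inj[].
Qed.

Lemma measurable_detour_threshold x E m k :
  (forall l, (l < size x)%N -> E (path_edge i0 x l)) ->
  measurable_fun setT ((fun t => detour_threshold x m t k) : sub_space E -> R).
Proof.
move=> xE; apply: measurable_bigmax; first exact: measurable_cst.
move=> l; rewrite mem_index_iota => /andP[_ lx].
by apply: measurable_weight_cyl; exact: xE.
Qed.

Lemma measurable_passes x : measurable [set t | passes x t].
Proof.
apply: measurable_all => f.
have [of_|nof] := boolP (off_path x f); last by rewrite (_ : [set _ | _] = setT)//;
  apply/seteqP; split.
apply: measurable_imp; first exact: measurable_const.
apply: measurable_lt; last exact: (measurable_bottleneck_weights i0).
apply: (measurable_path_threshold w01) => //.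
by case: x of_ => [/and3P[]|].
Qed.

(* The conditional probability of passes (rcons x i) when (x, i) has bottleneck m. *)
Definition passes_given x i m : \bar R :=
  P [set t | forall f, off_path (rcons x i) f ->
    detour_threshold x m t (size f.1) < bottleneck (w t) f].

(** The weights below [(x, i)] enter only through their bottleneck, while the path to [x] and the
    branches leaving it lie outside; Fubini integrates the latter first. *)
Lemma passes_integral x i :
  P [set t | passes (rcons x i) t] = (\int[P]_t passes_given x i (bottleneck (w t) (x, i)))%E.
Proof.
have dis : [disjoint below (x, i) & ~` below (x, i)].
  by apply/disj_setPS => f [].
pose B (z : sub_space (below (x, i)) * sub_space (~` below (x, i))) :=
  forall f, off_path (rcons x i) f ->
    detour_threshold x (bottleneck (w z.1) (x, i)) z.2 (size f.1) < bottleneck (w z.2) f.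
have := @indep_fubini_prob _ _ _ P _ _ _ _ mw iw _ _ dis [set z | B z].
rewrite /B/= => <-.
  congr (P _); apply/seteqP; split=> t /= h f of_; have := h f of_;
    by rewrite path_threshold_rcons.
apply: measurable_all => f.
have [of_|nof] := boolP (off_path (rcons x i) f); last by rewrite (_ : [set _ | _] = setT)//;
  apply/seteqP; split.
apply: measurable_imp; first exact: measurable_const.
apply: measurable_lt.
  apply: measurable_bigmax.
    exact: (measurableT_comp (measurable_bottleneck_cyl i0 w01 (@subset_refl _ _)) measurable_fst).
  move=> l; rewrite mem_index_iota => /andP[_ lx].
  apply: (measurableT_comp (@measurable_weight_cyl _ _ _ _ _ (~` below (x, i)) (path_edge i0 x l) _) measurable_snd).
  rewrite /below/= child_path_edge// => /size_prefixw; rewrite size_rcons size_takel//.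
  by rewrite ltnNge lx.
have fE : below f `<=` ~` below (x, i).
  move=> g fg; exact: (off_path_below of_ fg).
exact: (measurableT_comp (measurable_bottleneck_cyl i0 w01 fE) measurable_snd).
Qed.

Lemma measurable_passes_given x i : measurable_fun setT (passes_given x i).
Proof.
pose B : set (measurableTypeR R * T) := [set z | forall f, off_path (rcons x i) f ->
    detour_threshold x z.1 z.2 (size f.1) < bottleneck (w z.2) f].
have mB : measurable B.
  apply: measurable_all => f.
  apply: measurable_imp; first exact: measurable_const.
  apply: measurable_lt.
    apply: measurable_bigmax; first exact: measurable_fst.
    by move=> l _; exact: (measurableT_comp (mw _) measurable_snd).
  exact: (measurableT_comp (measurable_bottleneck_weights i0 mw w01 f) measurable_snd).
have := @measurable_fun_xsection _ _ _ _ _ P B mB.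
congr (measurable_fun _ _); apply/funext => m; rewrite /passes_given/=; congr (P _).
by apply/seteqP; split=> t; rewrite /xsection/= inE.
Qed.

(** The right-hand side is free of [i]. The edges leaving the longer path are those leaving the path
    to [x] and the sigma - 1 siblings of [(x, i)]; at the siblings the maximum runs over an empty
    range, so the threshold is [m]. *)
Lemma passes_given_sibling x i m : passes_given x i m =
  (P [set t | forall f, off_path x f -> (detour_threshold x m t (size f.1) < bottleneck (w t) f)%R] *
   ((fine (P [set t | (m < bottleneck (w t) ([::], i0))%R])) ^+ sigma.-1)%:E)%E.
Proof.
pose A := [set t | forall f, off_path x f -> (detour_threshold x m t (size f.1) < bottleneck (w t) f)%R].
pose B j := [set t | (m < bottleneck (w t) (x, j))%R].
have mB j : <<s cyl (below (x, j)) >> (B j).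
  apply: (@measurable_lt _ (sub_space (below (x, j)))); first exact: measurable_cst.
  exact: (measurable_bottleneck_cyl i0 w01).
have PB j : P (B j) = (fine (P [set t | m < bottleneck (w t) ([::], i0)]))%:E.
  rewrite fineK; first exact: (bottleneck_same_law i0 mw w01 iw wP).
  rewrite fin_num_measure//; apply: measurable_lt; first exact: measurable_cst.
  exact: (measurable_bottleneck_weights i0).
have [mI PI] := siblings_indep mw iw (enum_uniq (predC1 i)) mB.
rewrite (eq_bigr _ (fun j _ => PB j)) prod_const_prob cardC1 card_ord in PI.
rewrite -PI -(@sigma_cylinder_indep _ _ _ P _ _ _ _ mw iw (~` \bigcup_j below (x, j))
  (\bigcup_j below (x, j)) A) //.
- congr (P _); apply/seteqP; split=> t /=.
    move=> h; split=> [f of_|j]; first by apply: h; apply/off_path_rcons; left.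
    rewrite mem_enum inE => /eqP ji; have := h (x, j).
    rewrite /detour_threshold/= big_geq//; apply.
    by apply/off_path_rcons; right; exists j.
  move=> [hA hB] f /off_path_rcons[/hA//|[j /eqP ji ->]].
  by rewrite /detour_threshold/= big_geq//; apply: hB; rewrite mem_enum.
- by apply/disj_setPS => f [].
- apply: (@measurable_all _ (sub_space (~` \bigcup_j below (x, j)))) => f.
  have [of_|nof] := boolP (off_path x f); last first.
    rewrite (_ : [set _ | _] = setT); last by apply/seteqP; split.
    exact: (@measurableT _ (sub_space (~` \bigcup_j below (x, j)))).
  apply: measurable_imp; first exact: measurable_const.
  apply: measurable_lt.
    apply: measurable_detour_threshold => l lx [j _ /size_prefixw].
    by rewrite child_path_edge// size_rcons size_takel// ltnNge lx.
  apply: (measurable_bottleneck_cyl i0 w01) => g fg [j _ jg].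
  apply: (off_path_below of_ fg); case/prefixP: jg => u ->.
  by apply/prefixP; exists (j :: u); rewrite /child/= cat_rcons.
Qed.

Lemma passes_sibling x i j : P [set t | passes (rcons x i) t] = P [set t | passes (rcons x j) t].
Proof.
rewrite !passes_integral.
rewrite (@integral_bottleneck _ _ i0 _ _ P _ mw w01 iw wP (x, i) (x, j)).
- by apply: eq_integral => t _; rewrite !passes_given_sibling.
- exact: measurable_passes_given.
- by move=> r; exact: measure_ge0.
Qed.

Lemma backbone_passes x : {ae P, forall t, backbone (ipc (w t)) (size x) = x <-> passes x t}.
Proof.
apply: filterS (generic_ae i0 sigma_ge2 mw w01 iw wP) => t gt.
exact: (backbone_pathP i0 (w01 t) gt).
Qed.

(** Almost surely the events for the sigma children of [x] partition the event for [x], and they are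
    equally likely, so each level contributes a factor 1 / sigma. *)
Lemma backbone_uniform x :
  P [set t | backbone (ipc (w t)) (size x) = x] = (sigma%:R^-1 ^+ size x)%:E.
Proof.
have mv y := measurable_backbone_ipc mw (size y) y.
elim/last_ind: x => [|x i IH].
  rewrite expr0 -(@probability_setT _ _ _ P); apply: measure_ae_eq => //.
  apply: filterS (backbone_passes [::]) => t [_ h]; split=> // _; apply: h.
  by move=> f /and3P[].
pose Q j := P [set t | backbone (ipc (w t)) (size (rcons x j)) = rcons x j].
have QP j : Q j = P [set t | passes (rcons x j) t].
  by apply: measure_ae_eq; [exact: mv|exact: measurable_passes|exact: backbone_passes].
have QE j : Q j = Q i by rewrite !QP; exact: passes_sibling.
have : P [set t | backbone (ipc (w t)) (size x) = x] = (\sum_(j < sigma) Q j)%E.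
  rewrite -(@measure_bigsetU_ord _ _ _ P sigma xpredT
    (fun j => [set t | backbone (ipc (w t)) (size (rcons x j)) = rcons x j])); last 2 first.
  - by move=> j; exact: mv.
  - apply/trivIsetP => j k _ _ /eqP jk; apply/seteqP; split=> // t /= [].
    by rewrite !size_rcons => -> /rcons_inj[].
  apply: measure_ae_eq => //.
    by apply: bigsetU_measurable => j _; exact: mv.
  apply: filterS (generic_ae i0 sigma_ge2 mw w01 iw wP) => t gt.
  have rv := ray_backbone_ipc i0 (w01 t) gt; rewrite -bigcup_seq; split=> [vx|[j _ /= vx]].
    case: (rv) => _ /(_ (size x))[j vj] _; exists j => /=; first exact: mem_index_enum.
    by rewrite size_rcons vj vx.
  by rewrite -(ray_take rv (leqnSn (size x))) -(size_rcons x j) vx -cats1 take_size_cat.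
have Qfin : Q i \is a fin_num by apply: fin_num_measure; exact: mv.
rewrite IH (eq_bigr (fun=> (fine (Q i))%:E)); last by move=> j _; rewrite fineK.
rewrite sumEFin sumr_const card_ord => -[h]; rewrite -/(Q i) -(fineK Qfin).
congr (_%:E); rewrite size_rcons exprS h -(mulr_natl (fine (Q i))) mulrA mulVf ?mul1r//.
by rewrite pnatr_eq0; lia.
Qed.

End UniformBackbone.

(** * Percolation in the branches *)

Section BernoulliFamilies.
Context {R : realType} (I : eqType).

Let Omega : pointedType := (I -> bool : pointedType).
Let coord (i : I) (o : Omega) : bool := o i.
Local Notation OmegaS := (g_sigma_algebraType (cylinder coord [set: I])).

Let measurable_configuration (d : measure_display) (T : measurableType d)
  (op : I -> T -> bool) : (forall i, measurable_fun setT (op i)) ->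
  measurable_fun setT (fun t => (fun i => op i t) : OmegaS).
Proof.
move=> mop; apply: (@measurability _ _ T OmegaS setT _ (cylinder coord [set: I])) => //.
move=> _ [_ [J [B [_ mB ->]]] <-]; rewrite setTI.
exact: (@cylinder_measurable _ _ _ _ _ op mop setT) (ex_intro _ J (ex_intro _ B _)).
Qed.

(** Allows the percolation obtained from the weights to be exchanged for any other one with the same
    parameter, possibly on another probability space. *)
Lemma bernoulli_law_unique (d : measure_display) (T : measurableType d)
    (P : probability T R) (d' : measure_display) (T' : measurableType d')
    (P' : probability T' R) (op : I -> T -> bool) (op' : I -> T' -> bool) :
  (forall i, measurable_fun setT (op i)) -> (forall i, measurable_fun setT (op' i)) ->
  mutually_independent P op -> mutually_independent P' op' ->
  (forall i, P (op i @^-1` [set true]) = P' (op' i @^-1` [set true])) ->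
  forall B : set (I -> bool), <<s cylinder (fun i (o : I -> bool) => o i) setT >> B ->
  P [set t | B (fun i => op i t)] = P' [set t | B (fun i => op' i t)].
Proof.
move=> mop mop' iop iop' opE B mB.
have mpre i b : measurable (op i @^-1` b) by exact: (measurable_preimage (mop i)).
have mpre' i b : measurable (op' i @^-1` b) by exact: (measurable_preimage (mop' i)).
pose X : {mfun T >-> OmegaS} := mfun_Sub (mem_set (measurable_configuration mop)).
pose X' : {mfun T' >-> OmegaS} := mfun_Sub (mem_set (measurable_configuration mop')).
have opB i (b : set bool) : P (op i @^-1` b) = P' (op' i @^-1` b).
  have opF : P (op i @^-1` [set false]) = P' (op' i @^-1` [set false]).
    have E (S : Type) (g : S -> bool) : g @^-1` [set false] = ~` (g @^-1` [set true]).
      by apply/seteqP; split=> s /=; case: (g s).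
    by rewrite !E !probability_setC ?opE.
  have E (S : Type) (g : S -> bool) : g @^-1` b =
      (if `[< b true >] then g @^-1` [set true] else set0) `|`
      (if `[< b false >] then g @^-1` [set false] else set0).
    apply/seteqP; split=> s /=.
      by case gs : (g s) => gb; [left|right]; case: asboolP.
    by case=> [|]; case: asboolP => // bb /= ->.
  have disE (S : Type) (g : S -> bool) (c c' : bool) :
      (if c then g @^-1` [set true] else set0) `&`
      (if c' then g @^-1` [set false] else set0) = set0.
    by apply/seteqP; split=> // s []; case: c; case: c' => //= ->.
  have mif c b' : measurable (if c then op i @^-1` b' else set0) by case: c.
  have mif' c b' : measurable (if c then op' i @^-1` b' else set0) by case: c.
  rewrite !E !measureU ?disE//.
  by congr (_ + _)%E; case: asboolP => _; rewrite ?measure0//; (exact: opE || exact: opF).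
apply: (@measure_unique _ _ OmegaS (cylinder coord [set: I]) (fun=> setT)
  erefl (@cylinder_setI _ _ _ _ coord setT) _ _ (distribution P X) (distribution P' X')) => //.
- by move=> _; exact: cylinder_setT.
- by rewrite bigcup_const.
- move=> _ [J [C [_ mC ->]]]; rewrite /distribution/pushforward/=.
  have E (S : Type) (g : I -> S -> bool) : [set s | forall i, i \in J -> C i (g i s)] =
      [set s | forall i, i \in undup J -> C i (g i s)].
    by apply/seteqP; split=> s h i; [rewrite mem_undup|rewrite -mem_undup] => /h.
  have := iop (undup J) C (undup_uniq _) mC; have := iop' (undup J) C (undup_uniq _) mC.
  rewrite -!E => h' h.
  rewrite -[LHS]/(P [set t | forall i, i \in J -> C i (op i t)]) h.
  rewrite -[RHS]/(P' [set t | forall i, i \in J -> C i (op' i t)]) h'.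
  by apply: eq_bigr => i _; exact: opB.
- by move=> _; exact: le_lt_trans (probability_le1 _ _) (ltry 1).
Qed.

End BernoulliFamilies.

Section BranchLaw.
Context {R : realType} (sigma : nat) (i0 : 'I_sigma).
Context {d : measure_display} {T : measurableType d} (P : probability T R).
Variable w : T -> edge sigma -> R.
Hypothesis mw : forall e, measurable_fun setT (w ^~ e).
Hypothesis w01 : forall t e, 0 <= w t e <= 1.
Hypothesis iw : mutually_independent P (fun e t => w t e).
Hypothesis wP : forall e p, 0 <= p <= 1 -> P [set t | w t e <= p] = p%:E.
Implicit Types (e f : edge sigma) (x : vertex sigma) (p m : R)
  (D : set (set (vertex sigma))).

Notation cyl E := (cylinder (fun e t => w t e) E).
Notation sub_space E := (g_sigma_algebraType (cyl E)).

(** The standard coupling: opening the edges of weight at most [p] realises percolation for all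
    parameters on one space. *)
Definition branch_cluster f p t : set (vertex sigma) :=
  open_cluster (fun e => w t e <= p) (branch f) f.1.

Definition branch_event f D p t : Prop :=
  finite_set (branch_cluster f p t) /\ D (branch_cluster f p t).

Definition branch_law f D p : R := fine (P [set t | branch_event f D p t]).

Lemma measurable_branch_event f D p : <<s cyl (below f) >> [set t | branch_event f D p t].
Proof.
apply: (@measurable_finite_open_cluster _ (sub_space (below f)) sigma
  (fun t e => w t e <= p)) => e fe.
by apply: measurable_le; [exact: measurable_weight_cyl|exact: measurable_cst].
Qed.

Lemma branch_lawE f D p : (branch_law f D p)%:E = P [set t | branch_event f D p t].
Proof.
rewrite fineK// fin_num_measure//.
exact: (sigma_cylinder_measurable mw (@measurable_branch_event f D p)).
Qed.

Lemma branch_law_ge0 f D p : 0 <= branch_law f D p.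
Proof. exact: fine_ge0. Qed.

Lemma branch_law_le f D p : branch_law f D p <= branch_law f setT p.
Proof.
rewrite -lee_fin !branch_lawE; apply: le_measure; rewrite ?inE.
- exact: (sigma_cylinder_measurable mw (@measurable_branch_event f D p)).
- exact: (sigma_cylinder_measurable mw (@measurable_branch_event f setT p)).
- by move=> t [].
Qed.

Lemma measurable_branch_law f D : measurable_fun setT (branch_law f D).
Proof.
pose B : set (measurableTypeR R * T) := [set z | branch_event f D z.1 z.2].
have mB : measurable B.
  apply: (@measurable_finite_open_cluster _ _ sigma
    (fun (z : measurableTypeR R * T) e => w z.2 e <= z.1)) => e fe.
  apply: measurable_le; last exact: measurable_fst.
  exact: (measurableT_comp (mw e) measurable_snd).
apply: measurableT_comp => //.
have := @measurable_fun_xsection _ _ _ _ _ P B mB.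
congr (measurable_fun _ _); apply/funext => p /=; congr (P _).
by apply/seteqP; split=> t; rewrite /xsection/= inE.
Qed.

Lemma branch_law_percolation (d' : measure_display) (T' : measurableType d')
    (Q : probability T' R) p (open : edge sigma -> {mfun T' >-> bool}) f D :
  0 <= p <= 1 -> bernoulli_percolation Q p open ->
  branch_law f D p = fine (Q [set t | finite_set (open_cluster (open^~ t) (branch f) f.1) /\
    D (open_cluster (open^~ t) (branch f) f.1)]).
Proof.
move=> p01 [Qp iQ]; congr fine.
pose op e (t : T) := w t e <= p.
have mop e : measurable_fun setT (op e) by apply: measurable_fun_ler.
pose B := [set o : edge sigma -> bool | finite_set (open_cluster o (branch f) f.1) /\
  D (open_cluster o (branch f) f.1)].
apply: (@bernoulli_law_unique _ _ _ _ P _ _ Q op open _ _ _ _ _ B) => //.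
- move=> J C uJ mC.
  have mwC e : measurable [set r : R | C e (r <= p)].
    by apply: measurable_preimage => //; apply: measurable_fun_ler.
  exact: (iw (B := fun e => [set r : R | C e (r <= p)]) uJ mwC).
- move=> e; rewrite Qp -(wP e p01); congr (P _).
- apply: (@measurable_finite_open_cluster _ (g_sigma_algebraType
    (cylinder (fun i (o : edge sigma -> bool) => o i) setT)) sigma (fun o => o)) => e _.
  apply: measurable_bool.
  exact: (@measurable_fun_cylinder (edge sigma -> bool) _ _ _ (fun i (o : edge sigma -> bool) => o i)).
Qed.

Section OffPath.
Variable x : vertex sigma.
Hypothesis x0 : (0 < size x)%N.

Definition off_branches : set (edge sigma) := \bigcup_(f in [set` off_edges x]) below f.

Lemma path_edge_off_branches l : (l < size x)%N -> (~` off_branches) (path_edge i0 x l).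
Proof.
by move=> lx [f]; rewrite /= mem_off_edges => of_; exact: off_path_path_edge of_ lx.
Qed.

Lemma below_path_off_branches e : prefix x (child e) -> (~` off_branches) e.
Proof.
by move=> xe [f]; rewrite /= mem_off_edges => of_ fe; exact: off_path_below of_ fe xe.
Qed.

Lemma measurable_path_threshold_off k :
  measurable_fun setT ((fun t => path_threshold i0 (w t) x k) : sub_space (~` off_branches) -> R).
Proof.
apply: (@measurable_path_threshold _ (sub_space (~` off_branches)) R sigma w w01 i0) => //.
  by move=> l lx; apply: measurable_weight_cyl; exact: path_edge_off_branches.
by move=> f xf; apply: measurable_weight_cyl; exact: below_path_off_branches.
Qed.

(** The weights outside the branches determine the thresholds and [g]. Once these are frozen, the
    branch events live on disjoint sets of edges and their probabilities multiply. *)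
Lemma off_branches_integral (D : edge sigma -> set (set (vertex sigma)))
    (g : sub_space (~` off_branches) -> R) :
  measurable_fun setT g -> (forall s, 0 <= g s) ->
  (\int[P]_(t in [set t | forall f, f \in off_edges x ->
      branch_event f (D f) (path_threshold i0 (w t) x (size f.1)) t]) (g t)%:E =
   \int[P]_t (g t * \prod_(f <- off_edges x)
      branch_law f (D f) (path_threshold i0 (w t) x (size f.1)))%:E)%E.
Proof.
move=> mg g0.
have dis : [disjoint ~` off_branches & off_branches] by apply/disj_setPS => f [].
pose B (z : sub_space (~` off_branches) * sub_space off_branches) := forall f,
  f \in off_edges x -> branch_event f (D f) (path_threshold i0 (w z.1) x (size f.1)) z.2.
have mB : measurable [set z | B z].
  apply: measurable_all => f; have [fx|nfx] := boolP (f \in off_edges x); last first.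
    by rewrite (_ : [set _ | _] = setT)//; apply/seteqP; split.
  apply: measurable_imp; first exact: measurable_const.
  apply: (@measurable_finite_open_cluster _ _ sigma
    (fun (z : sub_space (~` off_branches) * sub_space off_branches) e =>
       w z.2 e <= path_threshold i0 (w z.1) x (size f.1))) => e fe.
  apply: measurable_le.
    have eE : off_branches e by exists f.
    exact: (measurableT_comp (measurable_weight_cyl eE) measurable_snd).
  exact: (measurableT_comp (measurable_path_threshold_off _) measurable_fst).
rewrite (@indep_fubini_set _ _ _ P _ _ _ _ mw iw _ _ dis [set z | B z] g mB mg g0).
apply: eq_integral => s _; rewrite [RHS]EFinM; congr (_ * _)%E.
have [||_ PI] := @sigma_cylinder_indep_seq _ _ _ P _ _ _ _ mw iw _ (off_edges x) (@below sigma)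
  (fun f => [set t | branch_event f (D f) (path_threshold i0 (w s) x (size f.1)) t])
  (off_edges_uniq x).
- by move=> e f; rewrite !mem_off_edges; exact: off_path_disjoint.
- by move=> f _; exact: measurable_branch_event.
rewrite -prodEFin (eq_bigr _ (fun f _ => branch_lawE f (D f) _)); exact: PI.
Qed.

End OffPath.

End BranchLaw.

(** * Quotients, densities, partitions and clipped uniform weights *)

Lemma measurable_quotient (d : measure_display) (X : measurableType d) (R : realType)
  (f g : X -> R) : measurable_fun setT f -> measurable_fun setT g ->
  (forall t, 0 <= g t) -> measurable_fun setT (fun t => f t / g t).
Proof.
move=> mf mg g0; apply: (measurability _ (RGenOInfty.measurableE R)) => //.
move=> _ [_ [a ->] <-]; rewrite setTI.
(* The first alternative is a zero denominator, where the quotient is 0 by convention. This occurs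
   for the probability of a finite cluster, which vanishes at parameter 1. *)
rewrite [X in measurable X](_ : _ = [set t | (g t <= 0 /\ a < 0) \/ (0 < g t /\ a * g t < f t)]).
  apply: measurable_disj; apply: measurable_conj.
  - by apply: measurable_le => //; exact: measurable_cst.
  - exact: measurable_const.
  - by apply: measurable_lt => //; exact: measurable_cst.
  - by apply: measurable_lt => //; apply: measurable_funM => //; exact: measurable_cst.
apply/seteqP; split=> t; rewrite /= in_itv/= andbT.
  have [gt0|gt0] := ltP 0 (g t); first by rewrite ltr_pdivlMr//; right.
  have -> : g t = 0 by apply/eqP; rewrite eq_le gt0 g0.
  by rewrite invr0 mulr0; left.
move=> [[gt0 a0]|[gt0]]; last by rewrite ltr_pdivlMr.
have -> : g t = 0 by apply/eqP; rewrite eq_le gt0 g0.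
by rewrite invr0 mulr0.
Qed.

Section DensityMeasure.
Context {d : measure_display} {T : measurableType d} {R : realType}.
Variables (m : {measure set T -> \bar R}) (f : T -> R).
Hypotheses (mf : measurable_fun setT f) (f0 : forall t, 0 <= f t).

Definition density_measure (A : set T) : \bar R := (\int[m]_(t in A) (f t)%:E)%E.
Local Notation mu := density_measure.

Let mu0 : mu set0 = 0%E.
Proof. by rewrite /density_measure integral_set0. Qed.

Let mu_ge0 A : (0 <= mu A)%E.
Proof. by apply: integral_ge0 => t _; rewrite lee_fin. Qed.

Let mu_sigma_additive : semi_sigma_additive mu.
Proof.
move=> F mF tF mUF; rewrite /density_measure; apply: cvg_toP.
  apply: ereal_nondecreasing_is_cvgn => a b ab; apply: lee_sum_nneg_natr => // k _ _.
  by apply: integral_ge0 => t _; rewrite lee_fin.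
rewrite ge0_integral_bigcup//=.
- by apply: measurable_funTS; apply/measurable_EFinP.
- by move=> t _; rewrite lee_fin.
Qed.

HB.instance Definition _ := isMeasure.Build _ _ _ mu mu0 mu_ge0 mu_sigma_additive.

(** Makes the integral side of the defining identity of conditional probability a measure in the
    event, so that partition and uniqueness arguments apply to it. *)
Lemma exists_density_measure : exists nu : {measure set T -> \bar R},
  forall A, nu A = (\int[m]_(t in A) (f t)%:E)%E.
Proof. by exists mu. Qed.

End DensityMeasure.

Lemma measure_eq_partition (d : measure_display) (T : measurableType d) (R : realType)
  (m1 m2 : {measure set T -> \bar R}) (I : countType) (h : T -> I) (A : set T) :
  (forall i, measurable [set t | h t = i]) -> measurable A ->
  (forall i, m1 (A `&` [set t | h t = i]) = m2 (A `&` [set t | h t = i])) -> m1 A = m2 A.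
Proof.
move=> mh mA m12.
pose F n := if pickle_inv n is Some i then A `&` [set t | h t = i] else set0.
have mF n : measurable (F n) by rewrite /F; case: pickle_inv => // i; exact: measurableI.
have tF : trivIset setT F.
  apply/trivIsetP => a b _ _ ab; apply/seteqP; split=> // t; rewrite /F /=.
  case Ea : (pickle_inv a) => [i|] [//=]; case Eb : (pickle_inv b) => [j|]//=.
  move=> [_ hi] [_ hj]; move/eqP: ab; apply.
  have := @pickle_invK I a; have := @pickle_invK I b.
  by rewrite Ea Eb /= => <- <-; rewrite -hi -hj.
have AF : A = \bigcup_n F n.
  apply/seteqP; split=> t; last by case=> n _; rewrite /F; case: pickle_inv => // i [].
  by move=> At; exists (pickle (h t)) => //; rewrite /F pickleK_inv.
rewrite AF !measure_semi_bigcup//; try by rewrite -AF.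
by apply: eq_eseriesr => n _; rewrite /F; case: pickle_inv => [i|]; rewrite ?measure0.
Qed.

Lemma uniform_prob01_le (R : realType) (p : R) : 0 <= p <= 1 ->
  uniform_prob (@ltr01 R) `]-oo, p]%classic = p%:E.
Proof.
move=> /andP[p0 p1]; rewrite /uniform_prob integral_uniform_pdf.
have -> : `]-oo, p]%classic `&` `[0, 1]%classic = `[0, p]%classic :> set R.
  apply/seteqP; split=> r /=; rewrite !in_itv/=; last by move=> /andP[-> rp]; rewrite rp (le_trans rp).
  by move=> [rp /andP[-> _]].
rewrite (eq_integral (cst 1%:E)); last first.
  move=> r; rewrite inE/= in_itv/= => /andP[r0 rp].
  by rewrite /uniform_pdf r0 (le_trans rp p1)/= subr0 invr1.
rewrite integral_cst//= mul1e lebesgue_measure_itv/= lte_fin.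
by case: ltgtP p0 => // [_ _|<- _]; rewrite ?sube0.
Qed.

Section ClippedWeights.
Context {R : realType} {d : measure_display} {T : measurableType d} (P : probability T R)
  (I : countType) (U : I -> {RV P >-> R}).
Hypothesis unifU : forall i (B : set R), measurable B ->
  distribution P (U i) B = uniform_prob (@ltr01 R) B.
Hypothesis indepU : mutually_independent P (fun i => U i : T -> R).

(* The weights lie in [0, 1] only almost surely; clipping them bounds every
   bottleneck everywhere. *)
Definition clip (r : R) : R := Num.max 0 (Num.min 1 r).

Lemma clip01 r : 0 <= clip r <= 1.
Proof. by rewrite le_max lexx ge_max ler01 ge_min lexx. Qed.

Lemma clip_id r : 0 <= r <= 1 -> clip r = r.
Proof. by move=> /andP[r0 r1]; rewrite /clip min_r// max_r. Qed.

Lemma measurable_clip : measurable_fun setT clip.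
Proof.
by apply: measurable_maxr; [exact: measurable_cst|apply: measurable_minr; [exact: measurable_cst|]].
Qed.

Lemma measurable_clip_weight i : measurable_fun setT (fun t => clip (U i t)).
Proof. exact: measurableT_comp measurable_clip _. Qed.

Lemma clip_independent : mutually_independent P (fun i t => clip (U i t)).
Proof.
move=> J B uJ mB; apply: (indepU (B := fun i => clip @^-1` B i) uJ) => i.
exact: measurable_preimage measurable_clip (mB i).
Qed.

Lemma clip_prob i p : 0 <= p <= 1 -> P [set t | clip (U i t) <= p] = p%:E.
Proof.
move=> p01; have /andP[p0 p1] := p01.
have [p1'|p1'] := ltP p 1.
  rewrite -(uniform_prob01_le p01) -(unifU i)//; congr (P _); apply/seteqP; split=> t;
    rewrite /= in_itv/= ge_max p0/= ge_min leNgt p1'//.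
rewrite (_ : p = 1); last by apply/eqP; rewrite eq_le p1.
rewrite (_ : [set _ | _] = setT) ?probability_setT//.
by apply/seteqP; split=> // t _ /=; have /andP[] := clip01 (U i t).
Qed.

Lemma clip_ae : {ae P, forall t, forall i, clip (U i t) = U i t}.
Proof.
apply: ae_all => i.
have mA : measurable [set t | (U i : T -> R) t \in `[0, 1]].
  exact: (measurable_preimage (measurable_funPT (U i)) (measurable_itv `[0, 1])).
have : {ae P, forall t, (U i : T -> R) t \in `[0, 1]}.
  exists (~` [set t | (U i : T -> R) t \in `[0, 1]]); split=> //; first exact: measurableC.
  rewrite probability_setC//.
  have -> : P [set t | (U i : T -> R) t \in `[0, 1]] = 1%E.
    rewrite -[LHS]/(distribution P (U i) `[0, 1]%classic) unifU//.
    by rewrite /uniform_prob integral_uniform_pdf1.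
  by rewrite subee.
by apply: filterS => t; rewrite in_itv; exact: clip_id.
Qed.

End ClippedWeights.

(** * The conditional law of the branches given the backbone and W *)

Section Main.
Context {R : realType} (sigma : nat) (i0 : 'I_sigma).
Hypothesis sigma_ge2 : (2 <= sigma)%N.
Context {d : measure_display} {T : measurableType d} (P : probability T R).
Variables w u : T -> edge sigma -> R.
Hypothesis mw : forall e, measurable_fun setT (w ^~ e).
Hypothesis mu : forall e, measurable_fun setT (u ^~ e).
Hypothesis u01 : forall t e, 0 <= u t e <= 1.
Hypothesis iu : mutually_independent P (fun e t => u t e).
Hypothesis uP : forall e p, 0 <= p <= 1 -> P [set t | u t e <= p] = p%:E.
Hypothesis uw : {ae P, forall t, forall e, u t e = w t e}.
Implicit Types (e f : edge sigma) (x : vertex sigma) (p : R).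

Lemma generic_weights_ae : {ae P, forall t, u t = w t /\ generic (u t)}.
Proof.
apply: filterS2 uw (generic_ae i0 sigma_ge2 mu u01 iu uP) => t uwt gt.
by split=> //; apply/funext.
Qed.

Lemma unique_backbone_ae :
  {ae P, forall t, exists! v, infinite_self_avoiding_path (ipc (w t)) v}.
Proof.
apply: filterS generic_weights_ae => t [<- gt].
apply/exists_unique_rayP; first exact: ipc_downward_closed.
exact: (single_ray_ipc i0 (u01 t) gt).
Qed.

Lemma ray_mkseq (C : set (vertex sigma)) v (i : nat -> 'I_sigma) n : ray C v ->
  (forall k, (k < n)%N -> v k.+1 = rcons (v k) (i k)) <-> v n = mkseq i n.
Proof.
move=> rv; case: (rv) => v0 s _; elim: n => [|n IH]; first by split.
split=> [h|vn].
  by rewrite h// mkseqS; congr rcons; apply/IH => k kn; apply: h; exact: leqW.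
have [j vj] := s n; move: vn; rewrite vj mkseqS => /rcons_inj[/IH h ji] k.
by rewrite ltnS leq_eqVlt => /orP[/eqP ->|/h//]; rewrite vj ji.
Qed.

Lemma backbone_directions_prob n (i : nat -> 'I_sigma) :
  P [set t | forall k, (k < n)%N ->
    backbone (ipc (w t)) k.+1 = rcons (backbone (ipc (w t)) k) (i k)]
  = ((sigma%:R^-1) ^+ n)%:E.
Proof.
have := backbone_uniform i0 sigma_ge2 mu u01 iu uP (mkseq i n); rewrite size_mkseq => <-.
apply: measure_ae_eq; last 2 first.
- exact: measurable_backbone_ipc.
- apply: filterS generic_weights_ae => t [uwt gt] /=; rewrite -uwt.
  exact: ray_mkseq (ray_backbone_ipc i0 (u01 t) gt).
apply: measurable_all => k; apply: measurable_imp; first exact: measurable_const.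
rewrite [X in measurable X](_ : _ = [set t | exists x, backbone (ipc (w t)) k = x /\
    backbone (ipc (w t)) k.+1 = rcons x (i k)]).
  by apply: measurable_ex => x; apply: measurable_conj; exact: measurable_backbone_ipc.
by apply/seteqP; split=> t /=; [exists (backbone (ipc (w t)) k)|move=> [x [->]]].
Qed.

Lemma backbone_algebra_measurable : backbone_algebra w `<=` measurable.
Proof.
apply: smallest_sub; first exact: sigma_algebra_measurable.
move=> H [[k [x ->]]|[k [B [mB ->]]]]; first exact: measurable_backbone_ipc.
exact: measurable_preimage (measurable_max_future_weight mw k) mB.
Qed.

Variables (J : seq (edge sigma)) (A : edge sigma -> set (set (vertex sigma))).
Hypothesis uJ : uniq J.
Hypothesis mA : forall e, cluster_event (A e).

Definition conditional_branch_law e p : R :=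
  branch_law P u e (A e) p / branch_law P u e setT p.

Lemma conditional_branch_law_ge0 e p : 0 <= conditional_branch_law e p.
Proof. by apply: divr_ge0; exact: branch_law_ge0. Qed.

(** When finite clusters have probability 0, the numerator vanishes with the denominator, so the
    identity survives the convention for division by 0. *)
Lemma conditional_branch_lawM e p :
  conditional_branch_law e p * branch_law P u e setT p = branch_law P u e (A e) p.
Proof.
have [h0|h0] := eqVneq (branch_law P u e setT p) 0; last by rewrite divfK.
apply/eqP; rewrite h0 mulr0 eq_le branch_law_ge0/=.
by have := branch_law_le P mu e (A e) p; rewrite h0.
Qed.

Lemma measurable_conditional_branch_law e : measurable_fun setT (conditional_branch_law e).
Proof.
apply: measurable_quotient; [exact: (measurable_branch_law P mu)|exact: (measurable_branch_law P mu)|].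
by move=> p; exact: branch_law_ge0.
Qed.

(** The thresholds are those of [w], so the product is measurable for [backbone_algebra w]
    everywhere. The branch laws come from the coupling by [u] and are measurable in the parameter,
    which is not assumed of a given family of percolations. *)
Definition branch_version (t : T) : R :=
  \prod_(e <- J) (\1_[set s | off_backbone (w s) e] t *
    conditional_branch_law e (max_future_weight (w t) (size e.1))).

Lemma branch_version_ge0 t : 0 <= branch_version t.
Proof.
by apply: prodr_ge0 => e _; apply: mulr_ge0 => //; exact: conditional_branch_law_ge0.
Qed.

Lemma measurable_branch_version_sub (B : set R) : measurable B ->
  backbone_algebra w (branch_version @^-1` B).
Proof.
move=> mB; pose G := [set H : set T | exists k x, H = [set t | backbone (ipc (w t)) k = x]] `|`
  [set H | exists (k : nat) (B : set R), measurable B /\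
     H = [set t | B (max_future_weight (w t) k)]].
rewrite -[X in backbone_algebra _ X]setTI.
suff mv : measurable_fun setT (branch_version : g_sigma_algebraType G -> R) by exact: mv.
apply: measurable_prod => e _; apply: measurable_funM.
  apply: measurable_indic; apply: measurable_conj; last apply: measurable_not.
    by apply: sub_sigma_algebra; left; exists (size e.1), e.1.
  by apply: sub_sigma_algebra; left; exists (size e.1).+1, (child e).
apply: measurableT_comp; first exact: measurable_conditional_branch_law.
move=> _ C mC; rewrite setTI; apply: sub_sigma_algebra; right.
by exists (size e.1), C.
Qed.

Lemma measurable_branch_version : measurable_fun setT branch_version.
Proof.
move=> _ B mB; rewrite setTI; apply: backbone_algebra_measurable.
exact: measurable_branch_version_sub.
Qed.

Definition branches_event : set T := [set t | forall e, e \in J ->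
  off_backbone (w t) e /\ A e (ipc (w t) `&` [set` branch e])].

Lemma measurable_branches_event : measurable branches_event.
Proof.
apply: measurable_all => e; apply: measurable_imp; first exact: measurable_const.
apply: measurable_conj; first exact: measurable_off_backbone.
apply: (@measurable_cluster_event _ _ _ (fun t => ipc (w t) `&` [set` branch e])) => // x.
by apply: measurable_conj; [exact: measurable_ipc|exact: measurable_const].
Qed.

(** Both sides vanish. This disposes of words [x] incompatible with the cylinder, with the height or
    with the branches in [J]. *)
Lemma branches_prob_degenerate (H : set T) : measurable H ->
  {ae P, forall t, H t -> branch_version t = 0 /\ ~ branches_event t} ->
  P (branches_event `&` H) = (\int[P]_(t in H) (branch_version t)%:E)%E.
Proof.
move=> mH aeH; transitivity (0%E : \bar R).
  rewrite -(@measure0 _ _ _ P); apply: measure_ae_eq => //.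
    by apply: measurableI => //; exact: measurable_branches_event.
  by apply: filterS aeH => t h; split=> // -[bt /h[]].
rewrite -[LHS](integral0 P H); apply: ge0_ae_eq_integral => //.
- by apply: measurable_funTS; exact/measurable_EFinP/measurable_branch_version.
- by move=> t _; rewrite lee_fin branch_version_ge0.
- by apply: filterS aeH => t h /h[->].
Qed.

Section Cylinder.
Variables (n : nat) (X : nat -> set (vertex sigma)) (B : nat -> set R).
Hypothesis mB : forall k, measurable (B k).

(** Arbitrary sets [X k] and [B k] allow vacuous conditions at some heights, which makes these
    events a pi-system containing the whole space and the generators of [backbone_algebra w]. *)
Definition backbone_cylinder : set T := [set t | forall k, (k < n)%N ->
  X k (backbone (ipc (w t)) k) /\ B k (max_future_weight (w t) k)].

Lemma measurable_backbone_cylinder : measurable backbone_cylinder.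
Proof.
apply: measurable_all => k; apply: measurable_imp; first exact: measurable_const.
apply: measurable_conj; last exact: measurable_preimage (measurable_max_future_weight mw k) (mB k).
rewrite [X in measurable X](_ : _ = [set t | exists x, X k x /\ backbone (ipc (w t)) k = x]).
  apply: measurable_ex => x; apply: measurable_conj; first exact: measurable_const.
  exact: measurable_backbone_ipc.
by apply/seteqP; split=> t /=; [exists (backbone (ipc (w t)) k)|move=> [x [Xx ->]]].
Qed.

Section Path.
Variable x : vertex sigma.
Hypothesis x0 : (0 < size x)%N.
Hypothesis nx : (n <= size x)%N.
Hypothesis Jx : forall e, e \in J -> (size e.1 < size x)%N.

Let V t k := path_threshold i0 (u t) x k.
Let passing := [set t | backbone (ipc (w t)) (size x) = x].

Let prefix_cond : Prop := forall k, (k < n)%N -> X k (take k x).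
Let weights_cond t : Prop := forall k, (k < n)%N -> B k (V t k).
Let off_cond : Prop := forall e, e \in J -> off_path x e.

(** Separates the event into a condition on the word [x], one on weights outside the branches, and
    finiteness of every branch cluster; only the last one involves the branches. *)
Let passing_cylinderE t : u t = w t -> generic (u t) ->
  (backbone_cylinder `&` passing) t <->
  [/\ prefix_cond, weights_cond t &
    forall f, f \in off_edges x -> branch_event u f setT (V t (size f.1)) t].
Proof.
move=> uwt gt; have rv := ray_backbone_ipc i0 (u01 t) gt.
have WV : backbone (ipc (w t)) (size x) = x -> forall k, (k < n)%N ->
    backbone (ipc (w t)) k = take k x /\ max_future_weight (w t) k = V t k.
  rewrite -uwt => vx k kn; have kx := leq_trans kn nx; split.
    by rewrite -(ray_take rv (ltnW kx)) vx.
  exact: (path_threshold_backbone i0 (u01 t) gt).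
have passE : backbone (ipc (w t)) (size x) = x <->
    forall f, f \in off_edges x -> branch_event u f setT (V t (size f.1)) t.
  rewrite -uwt (backbone_pathP i0 (u01 t) gt x); split=> h f.
    rewrite mem_off_edges => /h; rewrite -(finite_open_cluster i0 (u01 t)) => fin.
    by split.
  by rewrite -mem_off_edges => /h[fin _]; apply/(finite_open_cluster i0 (u01 t)).
split=> [[hc /= vx]|[hX hB /passE vx]].
  split; last exact/passE.
    by move=> k kn; have [] := hc k kn; have [-> _] := WV vx k kn.
  by move=> k kn; have [_] := hc k kn; have [_ ->] := WV vx k kn.
by split=> //= k kn; have [-> ->] := WV vx k kn; split; [exact: hX|exact: hB].
Qed.

Let off_backbone_passing t e : u t = w t -> generic (u t) -> passing t -> e \in J ->
  (off_backbone (w t) e <-> off_path x e) /\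
  max_future_weight (w t) (size e.1) = V t (size e.1).
Proof.
rewrite /passing/= => <- gt vx eJ; split.
  exact: (off_backboneE i0 (u01 t) gt vx (Jx eJ)).
exact: (path_threshold_backbone i0 (u01 t) gt vx (Jx eJ)).
Qed.

(** Branches outside [J] are only required to be finite, which [branch_event] already contains. *)
Let D f := if f \in J then A f else setT.

Let branches_passingE t : u t = w t -> generic (u t) ->
  (branches_event `&` (backbone_cylinder `&` passing)) t <->
  [/\ prefix_cond /\ off_cond, weights_cond t &
    forall f, f \in off_edges x -> branch_event u f (D f) (V t (size f.1)) t].
Proof.
move=> uwt gt.
have AE e : e \in J -> off_path x e -> passing t ->
    ipc (w t) `&` [set` branch e] = branch_cluster u e (V t (size e.1)) t.
  move=> eJ oe pt; have [oeE WV] := off_backbone_passing uwt gt pt eJ.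
  have oe' : off_backbone (u t) e by rewrite uwt; apply/oeE.
  by rewrite -uwt (ipc_branch i0 (u01 t) gt oe') /branch_cluster -WV uwt.
split=> [[hb hc]|[[hX hoff] hB hf]].
  have [_ pt] := hc; have [hX hB hf] := (passing_cylinderE uwt gt).1 hc.
  have hoff e : e \in J -> off_path x e.
    move=> eJ; have [oe _] := hb e eJ.
    by have [h _] := off_backbone_passing uwt gt pt eJ; apply/h.
  split=> // f fx; have [fin _] := hf f fx; split=> //.
  rewrite /D; case: ifP => // fJ; rewrite -AE//; last exact: hoff.
  by have [] := hb f fJ.
have hc : (backbone_cylinder `&` passing) t.
  by apply/(passing_cylinderE uwt gt); split=> // f /hf[].
split=> // e eJ; have [_ pt] := hc.
have [h _] := off_backbone_passing uwt gt pt eJ; split; first by apply/h; exact: hoff.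
rewrite AE//; last exact: hoff.
by have [|_] := hf e; rewrite ?mem_off_edges ?/D ?eJ//; exact: hoff.
Qed.

Notation off_space := (g_sigma_algebraType (cylinder (fun e t => u t e) (~` off_branches x))).

Let weights_indic (t : off_space) : R := \1_[set s | weights_cond s] t.

Let measurable_V k : measurable_fun setT ((fun t => V t k) : off_space -> R).
Proof. exact: measurable_path_threshold_off. Qed.

Let measurable_weights_cond : measurable [set t : off_space | weights_cond t].
Proof.
apply: measurable_all => k; apply: measurable_imp; first exact: measurable_const.
exact: measurable_preimage (measurable_V k) (mB k).
Qed.

Let off_measurable : measurable `<=` (@measurable _ T : set (set off_space)).
Proof. exact: (sigma_cylinder_measurable mu). Qed.

Let measurable_VT k : measurable_fun setT (V ^~ k).
Proof. by move=> _ C mC; apply: off_measurable; exact: measurable_V. Qed.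

Let measurable_branch_events (D' : edge sigma -> set (set (vertex sigma))) :
  measurable [set t | forall f, f \in off_edges x -> branch_event u f (D' f) (V t (size f.1)) t].
Proof.
apply: measurable_all => f; apply: measurable_imp; first exact: measurable_const.
apply: (@measurable_finite_open_cluster _ _ sigma
  (fun t e => u t e <= V t (size f.1))) => e _.
exact: (measurable_le (mu e) (measurable_VT _)).
Qed.

(** Both sides reduce to one integral over the weights outside the branches. On the left each branch
    contributes [branch_law] of [D]; on the right it contributes the probability of finiteness,
    multiplied for branches in [J] by the conditional law, and these agree by
    [conditional_branch_lawM]. *)
Let branches_prob_off_path : off_cond -> prefix_cond ->
  P (branches_event `&` (backbone_cylinder `&` passing)) =
  (\int[P]_(t in backbone_cylinder `&` passing) (branch_version t)%:E)%E.
Proof.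
move=> hoff hX.
have mH : measurable (backbone_cylinder `&` passing).
  by apply: measurableI; [exact: measurable_backbone_cylinder|exact: measurable_backbone_ipc].
pose law_prod (t : off_space) : R := \prod_(e <- J) conditional_branch_law e (V t (size e.1)).
have mlaw : measurable_fun setT law_prod.
  apply: measurable_prod => e _.
  exact: measurableT_comp (measurable_conditional_branch_law e) (measurable_V _).
have mind : measurable_fun setT weights_indic := measurable_indic measurable_weights_cond.
pose E' D' := [set t | forall f, f \in off_edges x -> branch_event u f (D' f) (V t (size f.1)) t].
transitivity (\int[P]_(t in E' D) (weights_indic t)%:E)%E.
  rewrite integral_indic; [|exact: measurable_branch_events|exact: off_measurable].
  apply: measure_ae_eq.
  - by apply: measurableI => //; exact: measurable_branches_event.
  - by apply: measurableI; [exact: off_measurable|exact: measurable_branch_events].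
  apply: filterS generic_weights_ae => t [uwt gt].
  rewrite (branches_passingE uwt gt); split=> [[_ hB hf]|[hB hf]]; first by split.
  by split.
rewrite (off_branches_integral i0 mu u01 iu x0 _ mind)//.
transitivity (\int[P]_(t in E' (fun=> setT)) (weights_indic t * law_prod t)%:E)%E.
  rewrite (off_branches_integral i0 mu u01 iu x0); last 2 first.
  - exact: measurable_funM.
  - by move=> s; apply: mulr_ge0 => //; apply: prodr_ge0 => e _; exact: conditional_branch_law_ge0.
  apply: eq_integral => t _; congr (_%:E); rewrite -mulrA; congr (_ * _).
  (* [J] is duplicate-free and consists of off-path edges, so its product extends to [off_edges x]
     by factors 1 and can be merged with the other one. *)
  have -> : law_prod t = \prod_(f <- off_edges x)
      (if f \in J then conditional_branch_law f (V t (size f.1)) else 1).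
    rewrite -big_mkcond -big_filter; apply: perm_big; apply: uniq_perm => //.
      exact/filter_uniq/off_edges_uniq.
    move=> e; rewrite mem_filter mem_off_edges; case: (boolP (e \in J)) => //= eJ.
    by rewrite hoff.
  rewrite -big_split/=; apply: eq_bigr => f _; rewrite /D.
  case: ifP => _; last by rewrite mul1r.
  by rewrite conditional_branch_lawM.
rewrite integral_mkcond [RHS]integral_mkcond.
have mT (g : off_space -> R) : measurable_fun setT g -> measurable_fun setT (g : T -> R).
  by move=> mg _ C mC; apply: off_measurable; exact: mg.
apply: ge0_ae_eq_integral => //.
- apply/(measurable_restrictT _ (measurable_branch_events _)); apply: measurable_funTS.
  by apply/measurable_EFinP/mT/measurable_funM.
- apply/(measurable_restrictT _ mH); apply: measurable_funTS.
  exact/measurable_EFinP/measurable_branch_version.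
- move=> t _; rewrite patchE; case: ifP => // _; rewrite lee_fin; apply: mulr_ge0 => //.
  by apply: prodr_ge0 => e _; exact: conditional_branch_law_ge0.
- by move=> t _; rewrite patchE; case: ifP => // _; rewrite lee_fin branch_version_ge0.
apply: filterS generic_weights_ae => t [uwt gt] _; rewrite !patchE.
have [tH|tH] := pselect ((backbone_cylinder `&` passing) t).
  rewrite (mem_set tH); have [_ hB hf] := (passing_cylinderE uwt gt).1 tH.
  rewrite (mem_set (hf : E' (fun=> setT) t)); congr (_%:E).
  rewrite /weights_indic indicE (mem_set (hB : [set s | weights_cond s] t)) mul1r.
  rewrite /branch_version /law_prod !big_seq; apply: eq_bigr => e eJ.
  have [_ pt] := tH; have [oe ->] := off_backbone_passing uwt gt pt eJ.
  by rewrite indicE mem_set ?mul1r//; apply/oe/hoff.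
rewrite (memNset tH); case: ifP => // /set_mem hf; congr (_%:E).
rewrite /weights_indic indicE memNset ?mul0r// => hB; apply: tH.
by apply/(passing_cylinderE uwt gt); split.
Qed.

Lemma branches_prob_path :
  P (branches_event `&` (backbone_cylinder `&` [set t | backbone (ipc (w t)) (size x) = x])) =
  (\int[P]_(t in backbone_cylinder `&` [set t | backbone (ipc (w t)) (size x) = x])
     (branch_version t)%:E)%E.
Proof.
have mH : measurable (backbone_cylinder `&` passing).
  by apply: measurableI; [exact: measurable_backbone_cylinder|exact: measurable_backbone_ipc].
have [hX|nX] := pselect prefix_cond; last first.
  apply: branches_prob_degenerate => //.
  by apply: filterS generic_weights_ae => t [uwt gt] /(passing_cylinderE uwt gt)[].
have [hoff|/existsNP[e /not_implyP[eJ noff]]] := pselect off_cond.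
  exact: branches_prob_off_path.
apply: branches_prob_degenerate => //.
apply: filterS generic_weights_ae => t [uwt gt] ht; split; last first.
  by move=> bt; have [[_ /(_ e eJ)]] := (branches_passingE uwt gt).1 (conj bt ht).
have [_ pt] := ht; have [oe _] := off_backbone_passing uwt gt pt eJ.
rewrite /branch_version (big_rem e)//= indicE memNset ?mul0r//.
by move=> /oe.
Qed.

End Path.
Lemma branches_prob_cylinder :
  P (branches_event `&` backbone_cylinder) =
  (\int[P]_(t in backbone_cylinder) (branch_version t)%:E)%E.
Proof.
have [nu nuE] := exists_density_measure P measurable_branch_version branch_version_ge0.
(* A height beyond the constrained ones and beyond all branches in [J], so that the backbone vertex
   there decides which of these branches leave the backbone. *)
pose m := (maxn n (\max_(e <- J) size e.1)).+1.
rewrite -nuE setIC -[LHS]/(mrestr P measurable_branches_event backbone_cylinder).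
apply: (@measure_eq_partition _ _ _ _ _ _ (fun t => backbone (ipc (w t)) m)).
- by move=> x; exact: measurable_backbone_ipc.
- exact: measurable_backbone_cylinder.
move=> x; rewrite nuE /= /mrestr setIC.
have [xm|xm] := eqVneq (size x) m.
  rewrite -xm; apply: branches_prob_path; rewrite ?xm//.
    by rewrite /m leqW// leq_maxl.
  move=> e eJ; rewrite ltnS leq_max; apply/orP; right.
  exact: (@leq_bigmax_seq _ _ _ (fun e : edge sigma => size e.1)).
(* Almost surely the backbone vertex at height [m] is a word of length [m], so words of other
   lengths carry no mass. *)
apply: branches_prob_degenerate.
  by apply: measurableI; [exact: measurable_backbone_cylinder|exact: measurable_backbone_ipc].
apply: filterS generic_weights_ae => t [uwt gt] [_ /= vx]; exfalso.
move/eqP: xm; apply; rewrite -vx -uwt.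
exact: (ray_size (ray_backbone_ipc i0 (u01 t) gt)).
Qed.

End Cylinder.

Lemma backbone_algebra_cylinder : backbone_algebra w `<=`
  <<s [set H | exists n X B, (forall k, measurable (B k)) /\ H = backbone_cylinder n X B] >>.
Proof.
apply: sub_sigma_algebra2 => H [[k [x ->]]|[k [B [mB ->]]]].
  exists k.+1, (fun j => if j == k then [set x] else setT), (fun=> setT); split=> //.
  apply/seteqP; split=> t /=.
    by move=> vx j _; case: eqP => [->|].
  by move=> /(_ k (ltnSn k))[]; rewrite eqxx.
exists k.+1, (fun=> setT), (fun j => if j == k then B else setT); split=> [j|].
  by case: ifP.
apply/seteqP; split=> t /=.
  by move=> Bt j _; split=> //; case: eqP => [->|].
by move=> /(_ k (ltnSn k))[_]; rewrite eqxx.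
Qed.

(** Both sides are measures in [H], finite on the whole space, which agree on the pi-system of
    backbone cylinders. *)
Lemma branches_prob_backbone_algebra H : backbone_algebra w H ->
  (\int[P]_(t in H) (branch_version t)%:E)%E = P (branches_event `&` H).
Proof.
move=> /backbone_algebra_cylinder sH.
have [nu nuE] := exists_density_measure P measurable_branch_version branch_version_ge0.
rewrite -nuE setIC -[RHS]/(mrestr P measurable_branches_event H).
set G := [set _ | _] in sH.
have nuG A' : G A' -> nu A' = mrestr P measurable_branches_event A'.
  by move=> [n [X [B [mB ->]]]]; rewrite nuE -branches_prob_cylinder// /mrestr setIC.
have GT : G setT.
  by exists 0%N, (fun=> setT), (fun=> setT); split=> //; apply/seteqP; split.
apply: (@g_sigma_algebra_measure_unique _ _ _ G _ (fun=> setT) _ _ nu) => //.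
- by move=> _ [n [X [B [mB ->]]]]; exact: measurable_backbone_cylinder.
- by rewrite bigcup_const.
- move=> _ _ [n [X [B [mB ->]]]] [n' [X' [B' [mB' ->]]]].
  exists (maxn n n'), (fun k => [set x | ((k < n)%N -> X k x) /\ ((k < n')%N -> X' k x)]),
    (fun k => (if (k < n)%N then B k else setT) `&` (if (k < n')%N then B' k else setT)).
  split; first by move=> k; apply: measurableI; case: ifP.
  apply/seteqP; split=> t /=.
    move=> [h h'] k _; split; first by split=> kn; [have [] := h k kn|have [] := h' k kn].
    by split; case: ifP => // kn; [have [_] := h k kn|have [_] := h' k kn].
  move=> h; split=> k kn.
    have := h k; rewrite leq_max kn => /(_ isT)[[hX _] [hB _]].
    by split=> //; exact: hX.
  have := h k; rewrite leq_max kn orbT => /(_ isT)[[_ hX] [_ hB]].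
  by split=> //; exact: hX.
- by move=> _; rewrite nuG// /mrestr setTI (le_lt_trans (probability_le1 _ measurable_branches_event))// ltry.
Qed.

End Main.

Theorem proposition2p1 (R : realType) (sigma : nat) (hsigma : (2 <= sigma)%N)
  (* i.i.d. uniform (0,1) edge weights *)
  (d : measure_display) (T : measurableType d) (P : probability T R)
  (U : edge sigma -> {RV P >-> R})
  (hunif : forall e (B : set R), measurable B ->
     distribution P (U e) B = uniform_prob (@ltr01 R) B)
  (hindep : mutually_independent P (fun e => U e : T -> R))
  (* independent bond percolation with parameter p, for each p in [0,1] *)
  (d' : measure_display) (T' : measurableType d') (Q : R -> probability T' R)
  (open : R -> edge sigma -> {mfun T' >-> bool})
  (hperc : forall p : R, 0 <= p <= 1 ->
     bernoulli_percolation (Q p) p (open p)) :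
  let w (t : T) : edge sigma -> R := fun e => U e t in
  let C (t : T) := ipc (w t) in
  let v (t : T) := backbone (C t) in
  let W (t : T) := max_future_weight (w t) in
  [/\ {ae P, forall t, exists! p, infinite_self_avoiding_path (C t) p},
      (forall (n : nat) (i : nat -> 'I_sigma),
         P [set t | forall k, (k < n)%N -> v t k.+1 = rcons (v t k) (i k)]
         = ((sigma%:R^-1) ^+ n)%:E)
    & (forall (J : seq (edge sigma)) (A : edge sigma -> set (set (vertex sigma))),
         uniq J -> (forall e, cluster_event (A e)) ->
         is_cond_prob P (backbone_algebra w)
           [set t | forall e, e \in J ->
              off_backbone (w t) e /\ A e (C t `&` [set` branch e])]
           (fun t => \prod_(e <- J)
              (\1_[set s | off_backbone (w s) e] t *
               finite_cluster_law (Q (W t (size e.1))) (open (W t (size e.1)))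
                 e (A e))))].
Proof.
move=> w C v W.
pose i0 : 'I_sigma := Ordinal (ltnW hsigma).
(* Cluster, backbone and [W] remain those of [w]; bottlenecks and branch laws are formed with [u],
   which agrees with [w] almost surely. *)
pose u (t : T) (e : edge sigma) : R := clip (U e t).
have mw e : measurable_fun setT (w ^~ e) by exact: (measurable_funPT (U e)).
have mu e : measurable_fun setT (u ^~ e) := measurable_clip_weight U e.
have u01 t e : 0 <= u t e <= 1 := clip01 _.
have iu : mutually_independent P (fun e t => u t e) := clip_independent hindep.
have uP e p : 0 <= p <= 1 -> P [set t | u t e <= p] = p%:E := clip_prob hunif e (p := p).
have uw : {ae P, forall t, forall e, u t e = w t e} := clip_ae hunif.
split.
- exact: (unique_backbone_ae i0 hsigma mu u01 iu uP uw).
- exact: (backbone_directions_prob i0 hsigma mw mu u01 iu uP uw).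
move=> J A uJ mA; exists (branch_version P w u J A); split.
- by move=> B mB; exact: measurable_branch_version_sub.
- move=> H GH; exact: (branches_prob_backbone_algebra i0 hsigma mw mu u01 iu uP uw uJ mA GH).
apply: filterS (generic_weights_ae i0 hsigma mu u01 iu uP uw) => t [uwt gt].
apply: eq_bigr => e _; congr (_ * _).
rewrite -/(W t).
(* [hperc] covers only parameters in [0, 1], and [W] is known to lie there on the generic event;
   hence the formula with [Q] and [open] is matched with the version almost surely. *)
have W01 : 0 <= W t (size e.1) <= 1.
  by rewrite /W -uwt; exact: (max_future_weight01 i0 (u01 t) gt).
pose K s := open_cluster ((open (W t (size e.1)))^~ s) (branch e) e.1.
have pE D : branch_law P u e D (W t (size e.1)) =
    fine (Q (W t (size e.1)) [set s | finite_set (K s) /\ D (K s)]).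
  by apply: branch_law_percolation => //; exact: hperc.
have finE : [set s | finite_set (K s)] = [set s | finite_set (K s) /\ setT (K s)].
  by apply/seteqP; split=> s /= => [fK|[fK _]].
rewrite /conditional_branch_law !pE -finE; exact: erefl.
Qed.
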